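(* Let $\alpha,\mu,\sigma>0$ satisfy $4\alpha\mu-\sigma^2\ge0$, let $\theta\ge1$, and let $\Delta>0$ be arbitrary. Let $(X_n)_{n\ge0}$ be the $\theta$-Milstein approximation of the CIR equation with step size $\Delta$ and initial value $X_0\ge0$. Then the scheme preserves the long-term mean of the exact solution $X(t)$, i.e. $$\lim_{n\to\infty}\mathbb{E}[X_n]=\mu=\lim_{t\to\infty}\mathbb{E}[X(t)].$$
   Context: The CIR equation is the SDE $dX(t)=\alpha(\mu-X(t))\,dt+\sigma\sqrt{X(t)}\,dW(t)$, where $\alpha,\mu,\sigma$ are positive constants and $W$ is a standard Wiener process; for $X(0)=X_0\ge0$ it has a unique non-negative strong solution $X(t)$, and $\mathbb{E}[X(t)]=e^{-\alpha t}(\mathbb{E}[X_0]-\mu)+\mu$. The $\theta$-Milstein scheme for it with step size $\Delta>0$, $t_n=n\Delta$ and $\Delta W_n=W(t_{n+1})-W(t_n)$, is $$X_{n+1}=\frac{1}{1+\alpha\theta\Delta}\left\{(1-\alpha\Delta+\alpha\theta\Delta)X_n+\left(\alpha\mu-\frac{\sigma^2}{4}\right)\Delta+\sigma\sqrt{X_n}\,\Delta W_n+\frac{\sigma^2}{4}\Delta W_n^2\right\};$$ for $\theta\ge1$ and $4\alpha\mu\ge\sigma^2$ the iterates are non-negative, so the scheme is well defined. The initial value $X_0\ge0$ is deterministic or random, independent of $W$, with $\mathbb{E}[X_0]<\infty$. *)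

(* Defs.v *)
From HB Require Import structures.
From mathcomp Require Import all_boot all_order all_algebra.
From mathcomp Require Import all_classical all_reals all_analysis.

Set Implicit Arguments.
Unset Strict Implicit.
Unset Printing Implicit Defensive.

Import Order.TTheory GRing.Theory Num.Theory.
Import numFieldNormedType.Exports.

Local Open Scope classical_set_scope.
Local Open Scope ring_scope.

(* Stochastic processes are families indexed by all of R; only the indices
   t >= 0 are ever constrained. *)

Section stochastic_basis.
Context (d : measure_display) (T : measurableType d) (R : realType).
Variable P : probability T R.

Definition indep_classes (G H : set (set T)) : Prop :=
  forall A B, G A -> H B -> P (A `&` B) = (P A * P B)%E.

Definition events_of (Y : T -> R) : set (set T) :=
  preimage_set_system setT Y measurable.

Definition sigma_of (I : set R) (Y : R -> T -> R) : set (set T) :=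
  <<s \bigcup_(t in I) events_of (Y t) >>.

Definition sub_measurable (G : set (set T)) (Y : T -> R) : Prop :=
  events_of Y `<=` G.

Definition is_wiener (W : R -> {RV P >-> R}) : Prop :=
  [/\ {ae P, forall w, W 0 w = 0},
      {ae P, forall w, {within `[0, +oo[, continuous (fun t => W t w)}},
      (forall s t, 0 <= s -> s < t ->
         indep_classes (events_of (fun w => W t w - W s w))
                       (sigma_of `[0, s] W)) &
      (forall s t, 0 <= s -> s < t -> forall B : set R, measurable B ->
         P ((fun w => W t w - W s w) @^-1` B) =
         normal_prob 0 (Num.sqrt (t - s)) B)].

Definition indep_of_process (X0 : T -> R) (W : R -> {RV P >-> R}) : Prop :=
  indep_classes (events_of X0) (sigma_of `[0, +oo[ W).

(* The filtration generated by X0 and W, augmented by the P-null events. *)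
Definition augmented_filtration (X0 : T -> R) (W : R -> {RV P >-> R}) (t : R) :
    set (set T) :=
  <<s events_of X0 `|` \bigcup_(s in `[0, t]) events_of (W s) `|`
      [set N | measurable N /\ P N = 0%E] >>.

Definition cvg_in_probability (Y : nat -> T -> R) (Z : T -> R) : Prop :=
  forall eps : R, 0 < eps ->
    P [set w | eps <= `|Y n w - Z w|] @[n --> \oo] --> 0%E.

End stochastic_basis.

Section ito.
Context (d : measure_display) (T : measurableType d) (R : realType).
Variable P : probability T R.

(* The adapted step process equal to sp_coef i on
   [sp_time i, sp_time i.+1[ for i < sp_size, and to 0 elsewhere. *)
Record simple_process (F : R -> set (set T)) := SimpleProcess {
  sp_size : nat;
  sp_time : nat -> R;
  sp_coef : nat -> T -> R;
  sp_time_ge0 : forall i, 0 <= sp_time i;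
  sp_time_nd : forall i, sp_time i <= sp_time i.+1;
  sp_coef_adapted : forall i, sub_measurable (F (sp_time i)) (sp_coef i);
  sp_coef_bounded : exists c : R, forall i w, `|sp_coef i w| <= c
}.

Definition sp_value (F : R -> set (set T)) (H : simple_process F)
    (s : R) (w : T) : R :=
  \sum_(i < sp_size H)
    sp_coef H i w * (\1_(`[sp_time H i, sp_time H i.+1[) s : R).

Definition sp_integral (F : R -> set (set T)) (W : R -> {RV P >-> R})
    (H : simple_process F) (t : R) (w : T) : R :=
  \sum_(i < sp_size H)
    sp_coef H i w * (W (Num.min (sp_time H i.+1) t) w
                     - W (Num.min (sp_time H i) t) w).

(* M t is the Ito integral of H over [0, t] against W for every t >= 0: the
   limit in probability of the integrals of simple processes Hn such that
   \int_0^t |Hn - H|^2 ds tends to 0 in probability. *)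
Definition is_ito_integral (F : R -> set (set T)) (W : R -> {RV P >-> R})
    (H : R -> T -> R) (M : R -> {RV P >-> R}) : Prop :=
  exists Hn : nat -> simple_process F, forall t : R, 0 <= t ->
    (forall eps : R, 0 < eps ->
       P [set w | (eps%:E <= \int[lebesgue_measure]_(s in `[0%R, t])
                     ((sp_value (Hn n) s w - H s w) ^+ 2)%:E)%E]
         @[n --> \oo] --> 0%E) /\
    cvg_in_probability P (fun n => sp_integral W (Hn n) t) (M t).

End ito.

Section cir.
Context (d : measure_display) (T : measurableType d) (R : realType).
Variable P : probability T R.

(* X is a non-negative strong solution of
   dX = alpha (mu - X) dt + sigma sqrt X dW, X(0) = X0. *)
Definition is_cir_solution (alpha mu sigma : R) (W : R -> {RV P >-> R})
    (X0 : {RV P >-> R}) (X : R -> {RV P >-> R}) : Prop :=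
  [/\ (forall t, 0 <= t -> sub_measurable (augmented_filtration X0 W t) (X t)),
      (forall w, {within `[0, +oo[, continuous (fun t => X t w)}),
      {ae P, forall w, forall t, 0 <= t -> 0 <= X t w} &
      exists2 M : R -> {RV P >-> R},
        is_ito_integral (augmented_filtration X0 W) W
          (fun s w => Num.sqrt (X s w)) M &
        forall t, 0 <= t -> {ae P, forall w,
          X t w = X0 w
            + \int[lebesgue_measure]_(s in `[0, t]) (alpha * (mu - X s w))
            + sigma * M t w}].

Fixpoint theta_milstein (alpha mu sigma theta Delta : R)
    (W : R -> {RV P >-> R}) (X0 : T -> R) (n : nat) (w : T) : R :=
  if n is m.+1 then
    let x := theta_milstein alpha mu sigma theta Delta W X0 m w in
    let dW := W (m.+1%:R * Delta) w - W (m%:R * Delta) w in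
    (1 + alpha * theta * Delta)^-1 *
      ((1 - alpha * Delta + alpha * theta * Delta) * x
       + (alpha * mu - sigma ^+ 2 / 4) * Delta
       + sigma * Num.sqrt x * dW
       + sigma ^+ 2 / 4 * dW ^+ 2)
  else X0 w.

End cir.

(* Main.v *)
Require Import Defs.
From HB Require Import structures.
From mathcomp Require Import all_boot all_order all_algebra.
From mathcomp Require Import all_classical all_reals all_analysis.
From mathcomp Require Import measurable_realfun ring lra.
Import Order.TTheory GRing.Theory Num.Theory.
Import numFieldNormedType.Exports.
Local Open Scope classical_set_scope.
Local Open Scope ring_scope.


(** Both limits come from an affine equation satisfied by the mean, and the point
    in both cases is that the stochastic term has mean zero. This is read off
    from exponential bounds: if E[exp(l Y - l^2 Z)] <= 1 for every real l, with Y
    and Z integrable, then 1 + x <= exp x gives l E[Y] <= l^2 E[Z] for all l, and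
    l -> 0 from both sides forces E[Y] = 0 ([exp_supermartingale_mean0]).

    The source of such bounds is [wiener_exp_step]: an increment of W over [s, t]
    is Gaussian and independent of the augmented filtration at time s
    ([wiener_increment_indep]), so freezing the variables xi and Z known at time s
    and completing the square yields
    E[Z exp(xi (W t - W s) - xi^2 (t - s) / 2)] = E[Z].

    For the scheme, xi = l sqrt(X n) and Z = 1 show that sqrt(X n) times the
    increment has mean zero. As the squared increment has mean Delta, the distance
    of E[X n] to mu is multiplied at each step by
    (1 + alpha (theta - 1) Delta) / (1 + alpha theta Delta), which lies in ]0, 1[
    ([milstein_mean_step]).

    For the exact solution, the Ito integral M t is only a limit in probability of
    integrals of simple processes, and not even the integrability of X t is known
    beforehand. Iterating [wiener_exp_step] gives
    E[exp(l int Hn dW - l^2/2 int Hn^2 ds)] = 1 for simple Hn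
    ([simple_exp_moment]), and Fatou's lemma in probability turns this into
    E[exp(l M t - l^2 int_0^t X ds)] <= 1 ([ito_exp_bound]), with no localization.
    The equation expresses M t through X t, X 0 and int_0^t X ds; since X >= 0,
    the choice l = alpha / (2 sigma) makes the exponent dominate a positive
    multiple of X t + (alpha / 2) int_0^t X ds, up to the integrable X 0 and a
    constant. Hence both are integrable ([cir_integrable]), so E[M t] = 0, and
    Tonelli's theorem gives m t = m 0 + alpha int_0^t (mu - m s) ds for
    m t = E[X t]. Then exp(alpha t) (m t - mu) is constant
    ([mean_reversion_cvg]). *)

Set Implicit Arguments.
Unset Strict Implicit.
Unset Printing Implicit Defensive.

(** * Independence and joint laws *)

Section independence.
Context (d : measure_display) (T : measurableType d) (R : realType).
Variable P : probability T R.

(** For a fixed event B of H, the finite measures A |-> P (A `&` B) and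
    A |-> P A * P B agree on a pi-system, hence on the sigma-algebra it
    generates. *)
Lemma indep_classes_generated (G H : set (set T)) :
  setI_closed G -> G setT -> G `<=` measurable -> H `<=` measurable ->
  indep_classes P G H -> indep_classes P <<s G >> H.
Proof.
move=> GI GT Gm Hm GH A B sGA HB.
have mB := Hm _ HB.
have PBfin : P B = (fine (P B))%:E by rewrite fineK// fin_num_measure.
have b0 : 0 <= fine (P B) by rewrite fine_ge0.
pose m1 : {measure set T -> \bar R} := mrestr P mB.
pose m2 : {measure set T -> \bar R} := mscale (NngNum b0) P.
have m1E X : m1 X = P (X `&` B) by [].
have m2E X : m2 X = (P X * P B)%E by rewrite muleC PBfin.
rewrite -m1E -m2E.
apply: (@g_sigma_algebra_measure_unique _ _ _ G Gm (fun=> setT)) => //.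
- by rewrite bigcup_const//; exists 0%N.
- by move=> X GX; rewrite m1E m2E; exact: GH.
- by move=> k; rewrite m1E setTI ltey_eq fin_num_measure.
Qed.

(** The joint law of independent variables is the product of their laws, so this
    is Tonelli's theorem. *)
Lemma ge0_integral_indep d1 d2 (T1 : measurableType d1)
    (T2 : measurableType d2) (U : T -> T1) (V : T -> T2)
    (f : T1 * T2 -> \bar R)
    (mU : measurable_fun setT U) (mV : measurable_fun setT V) :
  (forall A B, measurable A -> measurable B ->
    P (U @^-1` A `&` V @^-1` B) = (P (U @^-1` A) * P (V @^-1` B))%E) ->
  measurable_fun setT f -> (forall z, 0 <= f z)%E ->
  (\int[P]_w f (U w, V w) = \int[P]_w \int[P]_w' f (U w, V w'))%E.
Proof.
move=> ind mf f0.
pose Up : {mfun T >-> T1} := HB.pack U (isMeasurableFun.Build _ _ _ _ _ mU).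
pose Vp : {mfun T >-> T2} := HB.pack V (isMeasurableFun.Build _ _ _ _ _ mV).
have mUV : measurable_fun setT (fun w => (U w, V w)).
  exact/measurable_fun_pair.
pose UV : {mfun T >-> (T1 * T2)%type} :=
  HB.pack (fun w => (U w, V w)) (isMeasurableFun.Build _ _ _ _ _ mUV).
transitivity (\int[distribution P UV]_z f z)%E.
  by rewrite ge0_integral_distribution.
transitivity (\int[(distribution P Up \x distribution P Vp)%E]_z f z)%E.
  apply: eq_measure_integral => X mX _; apply/esym.
  by apply: product_measure_unique => // A B mA mB; exact: ind.
rewrite fubini_tonelli1// /fubini_F ge0_integral_distribution//; first last.
- by move=> y; apply: integral_ge0.
- exact: measurable_fun_fubini_tonelli_F.
apply: eq_integral => w _ /=; rewrite ge0_integral_distribution//.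
exact: measurableT_comp mf (measurable_pair1 _).
Qed.

(** The freezing lemma: everything known to the sigma-algebra generated by G can
    be held fixed while V is integrated out. It is the previous lemma for the
    identity map from T to T equipped with that sub-sigma-algebra. *)
Lemma ge0_integral_indep_sigma (G : set (set T)) (V : T -> R)
    (f : g_sigma_algebraType G * R -> \bar R) :
  G `<=` measurable -> measurable_fun setT V ->
  indep_classes P <<s G >> (events_of V) ->
  measurable_fun setT f -> (forall z, 0 <= f z)%E ->
  (\int[P]_w f (w, V w) = \int[P]_w \int[P]_w' f (w, V w'))%E.
Proof.
move=> Gm mV ind mf f0.
have sGm : <<s G >> `<=` measurable.
  exact: smallest_sub (@sigma_algebra_measurable _ T) Gm.
apply: (@ge0_integral_indep _ _ (g_sigma_algebraType G) _ idfun V f) => //.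
- by move=> _ /= B mB; rewrite setTI preimage_id; exact: sGm.
- move=> A B mA mB; rewrite preimage_id; apply: ind => //.
  by exists B => //; rewrite setTI.
Qed.
End independence.

(** * Integrability and exponential bounds *)

Section expectation_bounds.
Context (d : measure_display) (T : measurableType d) (R : realType).
Variable P : {measure set T -> \bar R}.
Implicit Types f g : T -> R.

Lemma ge0_integrable_lty f : measurable_fun setT f -> (forall w, 0 <= f w) ->
  (\int[P]_w (f w)%:E < +oo)%E -> P.-integrable setT (EFin \o f).
Proof.
move=> mf f0 foo; apply/integrableP; split; first exact/measurable_EFinP.
by under eq_integral do rewrite /= ger0_norm//.
Qed.

Lemma integrable_measurable f : P.-integrable setT (EFin \o f) ->
  measurable_fun setT f.
Proof. by move=> fi; apply/measurable_EFinP; exact: measurable_int fi. Qed.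

Lemma integrable_le f g : measurable_fun setT f ->
  (forall w, `|f w| <= g w) -> P.-integrable setT (EFin \o g) ->
  P.-integrable setT (EFin \o f).
Proof.
move=> mf fg; apply: le_integrable => //; first exact/measurable_EFinP.
by move=> w _; rewrite /= lee_fin (le_trans (fg w))// ler_norm.
Qed.

Lemma Rintegral_le_ge0 f g (c : R) :
  P.-integrable setT (EFin \o f) -> measurable_fun setT g ->
  (forall w, 0 <= g w) -> (forall w, f w <= g w) ->
  (\int[P]_w (g w)%:E <= c%:E)%E -> \int[P]_w f w <= c.
Proof.
move=> fi mg g0 fg gc.
have gi : P.-integrable setT (EFin \o g).
  by apply: ge0_integrable_lty => //; rewrite (le_lt_trans gc)// ltry.
rewrite -lee_fin fineK; last exact: integrable_fin_num fi.
by apply: le_trans gc; apply: le_integral => // w _; rewrite lee_fin.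
Qed.

End expectation_bounds.

Section mean_zero.
Context (d : measure_display) (T : measurableType d) (R : realType).
Variable P : probability T R.

Lemma Rintegral_prob_cst (c : R) : \int[P]_w c = c.
Proof.
rewrite Rintegral_cst// -[RHS]mulr1; congr (_ * _).
exact: (congr1 fine (probability_setT P)).
Qed.

(** Expanding the exponential to first order in l compares l E[Y] with
    l^2 E[Z]; for l small of either sign this leaves only E[Y] = 0. *)
Lemma exp_supermartingale_mean0 (Y Z : T -> R) :
  P.-integrable setT (EFin \o Y) -> P.-integrable setT (EFin \o Z) ->
  (forall l : R, (\int[P]_w (expR (l * Y w - l ^+ 2 * Z w))%:E <= 1)%E) ->
  \int[P]_w Y w = 0.
Proof.
move=> Yi Zi H; set m := \int[P]_w Y w; set z := \int[P]_w Z w.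
have mY : measurable_fun setT Y := integrable_measurable Yi.
have mZ : measurable_fun setT Z := integrable_measurable Zi.
have key l : l * m - l ^+ 2 * z <= 0.
  have iY : P.-integrable setT (EFin \o (fun w => l * Y w)).
    by apply: eq_integrable (integrableZl measurableT l Yi).
  have iZ : P.-integrable setT (EFin \o (fun w => l ^+ 2 * Z w)).
    by apply: eq_integrable (integrableZl measurableT (l ^+ 2) Zi).
  have iYZ : P.-integrable setT (EFin \o (fun w => l * Y w - l ^+ 2 * Z w)).
    by apply: eq_integrable (integrableB measurableT iY iZ).
  have i1 : P.-integrable setT (EFin \o (fun=> 1 : R)).
    exact: finite_measure_integrable_cst.
  have i : P.-integrable setT
      (EFin \o (fun w => 1 + (l * Y w - l ^+ 2 * Z w))).
    by apply: eq_integrable (integrableD measurableT i1 iYZ).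
  have : \int[P]_w (1 + (l * Y w - l ^+ 2 * Z w)) <= 1.
    apply: (Rintegral_le_ge0 i _ _ _ (H l)).
    - apply/measurableT_comp => //; apply: measurable_funB;
        exact: measurable_funM.
    - by move=> w; exact: expR_ge0.
    - by move=> w; exact: expR_ge1Dx.
  rewrite RintegralD// RintegralB// !RintegralZl// Rintegral_prob_cst.
  by rewrite gerDl.
apply/eqP/negPn/negP => m0.
(* With l = m / (|z| + 1), l m exceeds l^2 z as soon as m is non-zero. *)
have c0 : 0 < `|z| + 1 by rewrite ltr_wpDl.
have := key (m / (`|z| + 1)); apply/negP; rewrite -ltNge.
rewrite (_ : _ - _ = (m / (`|z| + 1)) ^+ 2 * (`|z| + 1 - z)); last first.
  by field; rewrite gt_eqF.
rewrite mulr_gt0//.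
  by rewrite exprn_even_gt0//= mulf_neq0// invr_neq0// gt_eqF.
by rewrite subr_gt0 (le_lt_trans (ler_norm z))// ltrDl.
Qed.

End mean_zero.

(** * Gaussian moments *)

Section normal_moments.
Context (R : realType).
Local Notation mu := (@lebesgue_measure R).

(** The density [normal_pdf] is almost everywhere the Radon-Nikodym derivative of
    [normal_prob], for which the change of variables is available. *)
Lemma ge0_integral_normal_prob (m s : R) (f : R -> \bar R) :
  measurable_fun setT f -> (forall x, 0 <= f x)%E ->
  (\int[normal_prob m s]_x f x = \int[mu]_x (f x * (normal_pdf m s x)%:E))%E.
Proof.
move=> mf f0.
have dom := normal_prob_dominates m s.
rewrite -(Radon_Nikodym_SigmaFinite.change_of_variables dom)//.
have ipdf := Radon_Nikodym_SigmaFinite.f_integrable dom.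
have mpdf := measurable_normal_pdf m s.
apply: ae_eq_integral => //.
- by apply: emeasurable_funM => //; exact: measurable_int ipdf.
- by apply: emeasurable_funM => //; exact/measurable_EFinP.
- apply: ae_eqe_mul2l => /=; apply: integral_ae_eq => //.
  + exact/measurable_EFinP.
  + by move=> E _ mE; rewrite -Radon_Nikodym_SigmaFinite.f_integral.
Qed.

(** Completing the square: an exponential tilt shifts the mean by a s^2. *)
Lemma normal_pdf_tilt (s a y : R) : s != 0 ->
  expR (a * y - a ^+ 2 * s ^+ 2 / 2) * normal_pdf 0 s y =
  normal_pdf (a * s ^+ 2) s y.
Proof.
move=> s0; rewrite !normal_pdfE// /normal_fun mulrCA -expRD.
congr (_ * _); apply: (congr1 (@expR R)).
by rewrite -!(mulr_natr (s ^+ 2)); field.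
Qed.

(** A Gaussian factor changes the standard deviation from s to r; the ratio r / s
    is that of the normalizing constants. *)
Lemma normal_pdf_rescale (s r y : R) : 0 < s -> 0 < r ->
  expR (- (r ^- 2 - s ^- 2) * y ^+ 2 / 2) * normal_pdf 0 s y =
  r / s * normal_pdf 0 r y.
Proof.
move=> s0 r0; have sn0 : s != 0 by rewrite gt_eqF.
have rn0 : r != 0 by rewrite gt_eqF.
rewrite !normal_pdfE// /normal_fun mulrCA -expRD [RHS]mulrA; congr (_ * _).
  have peakE (x : R) : 0 < x -> normal_peak x = x^-1 * (Num.sqrt (pi *+ 2))^-1.
    move=> x0; rewrite /normal_peak -mulrnAr sqrtrM ?sqr_ge0//.
    by rewrite sqrtr_sqr gtr0_norm// invfM.
  by rewrite !peakE// mulrA; congr (_ * _); field; rewrite rn0.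
apply: (congr1 (@expR R)).
by rewrite -!(mulr_natr (_ ^+ 2)); field; rewrite rn0.
Qed.

Lemma normal_exp_moment (s a : R) : 0 < s ->
  (\int[normal_prob 0 s]_y (expR (a * y - a ^+ 2 * s ^+ 2 / 2))%:E = 1)%E.
Proof.
move=> s0; rewrite ge0_integral_normal_prob//; last first.
  apply/measurable_EFinP/measurableT_comp => //.
  by apply: measurable_funB => //; exact: measurable_funM.
rewrite -(integral_normal_pdf (a * s ^+ 2) s); apply: eq_integral => y _.
by rewrite -EFinM normal_pdf_tilt// gt_eqF.
Qed.

Lemma normal_gauss_moment (s r : R) : 0 < s -> 0 < r ->
  (\int[normal_prob 0 s]_y (expR (- (r ^- 2 - s ^- 2) * y ^+ 2 / 2))%:E
   = (r / s)%:E)%E.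
Proof.
move=> s0 r0; rewrite ge0_integral_normal_prob//; last first.
  apply/measurable_EFinP/measurableT_comp => //.
  by apply: measurable_funM => //; apply: measurable_funM => //;
    exact: measurable_funX.
under eq_integral do rewrite -EFinM normal_pdf_rescale// EFinM.
rewrite integralZl//; last exact: integrable_normal_pdf.
by rewrite integral_normal_pdf mule1.
Qed.

End normal_moments.

Section normal_law.
Context (d : measure_display) (T : measurableType d) (R : realType).
Variables (P : probability T R) (V : T -> R) (s : R).
Hypotheses (mV : measurable_fun setT V) (s0 : 0 < s)
  (lawV : forall B : set R, measurable B -> P (V @^-1` B) = normal_prob 0 s B).

Lemma ge0_integral_normal_law (f : R -> \bar R) :
  measurable_fun setT f -> (forall x, 0 <= f x)%E ->
  (\int[P]_w f (V w) = \int[normal_prob 0 s]_y f y)%E.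
Proof.
move=> mf f0.
have mV' : measurable_fun setT (V : T -> measurableTypeR R) := mV.
pose Vp : {mfun T >-> measurableTypeR R} :=
  HB.pack V (isMeasurableFun.Build _ _ _ _ _ mV').
transitivity (\int[distribution P Vp]_y f y)%E.
  by rewrite (ge0_integral_distribution Vp).
by apply: eq_measure_integral => B mB _; exact: lawV.
Qed.

Lemma normal_law_exp_moment (a : R) :
  (\int[P]_w (expR (a * V w - a ^+ 2 * s ^+ 2 / 2))%:E = 1)%E.
Proof.
rewrite -(normal_exp_moment a s0) -ge0_integral_normal_law//.
apply/measurable_EFinP/measurableT_comp => //.
by apply: measurable_funB => //; exact: measurable_funM.
Qed.

Lemma normal_law_gauss_moment (r : R) : 0 < r ->
  (\int[P]_w (expR (- (r ^- 2 - s ^- 2) * V w ^+ 2 / 2))%:E = (r / s)%:E)%E.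
Proof.
move=> r0; rewrite -(normal_gauss_moment s0 r0) -ge0_integral_normal_law//.
apply/measurable_EFinP/measurableT_comp => //.
by apply: measurable_funM => //; apply: measurable_funM => //;
  exact: measurable_funX.
Qed.

Lemma measurable_gauss_factor (c : R) :
  measurable_fun setT (fun w => expR (c * V w ^+ 2 / 2)).
Proof.
apply/measurableT_comp => //.
by apply: measurable_funM => //; apply: measurable_funM => //;
  exact: measurable_funX.
Qed.

Lemma normal_law_integrable_sqr :
  P.-integrable setT (EFin \o (fun w => V w ^+ 2)).
Proof.
(* Rescaling from s to 2 s uses the factor exp(3 V^2 / (8 s^2)), which is
   integrable and dominates a multiple of V^2. *)
have c0 : 0 < 3 / 8 * s ^- 2.
  by rewrite mulr_gt0 ?divr_gt0// invr_gt0 exprn_gt0.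
apply: (@integrable_le _ _ _ P (fun w => V w ^+ 2) (fun w =>
  (3 / 8 * s ^- 2)^-1 * expR (- ((2 * s) ^- 2 - s ^- 2) * V w ^+ 2 / 2))).
- exact: measurable_funX.
- move=> w; rewrite ger0_norm ?sqr_ge0// mulrC ler_pdivlMr//.
  apply: le_trans (expR_ge1Dx _).
  suff -> : - ((2 * s) ^- 2 - s ^- 2) * V w ^+ 2 / 2 =
      V w ^+ 2 * (3 / 8 * s ^- 2) by rewrite lerDr.
  by field; rewrite gt_eqF.
- apply: ge0_integrable_lty.
  + by apply: measurable_funM => //; exact: measurable_gauss_factor.
  + by move=> w; rewrite mulr_ge0 ?expR_ge0// invr_ge0 ltW.
  + under eq_integral do rewrite EFinM.
    rewrite ge0_integralZl//; last 2 first.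
    * by apply/measurable_EFinP; exact: measurable_gauss_factor.
    * by rewrite lee_fin invr_ge0 ltW.
    by rewrite normal_law_gauss_moment// ?mulr_gt0// -EFinM ltry.
Qed.

(** The Gaussian integrals E[exp(- c V^2 / 2)], as functions of c, lie above
    their tangent line at c = 0, whose slope is minus half the second moment;
    since these integrals are explicit, the slope can be read off. *)
Lemma normal_law_second_moment : \int[P]_w (V w ^+ 2) = s ^+ 2.
Proof.
set m := Rintegral _ _ _.
have i2 := normal_law_integrable_sqr.
(* k is the second moment in units of 2 s^2, to be shown equal to 1/2. *)
pose k := m / (2 * s ^+ 2).
have k0 : 0 <= k.
  rewrite divr_ge0//; last by rewrite mulr_ge0// sqr_ge0.
  by apply: Rintegral_ge0 => w _; exact: sqr_ge0.
have tangent x : 0 < x -> (1 - x) * x ^+ 2 <= (1 - x) * (1 + x) * k.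
  move=> x0.
  pose c := ((s * x) ^- 2 - s ^- 2) / 2.
  have ic : P.-integrable setT (EFin \o (fun w => c * V w ^+ 2)).
    by apply: eq_integrable (integrableZl measurableT c i2).
  have i1 : P.-integrable setT (EFin \o (fun=> 1 : R)).
    exact: finite_measure_integrable_cst.
  have i : P.-integrable setT (EFin \o (fun w => 1 - c * V w ^+ 2)).
    by apply: eq_integrable (integrableB measurableT i1 ic).
  have : \int[P]_w (1 - c * V w ^+ 2) <= x.
    have := normal_law_gauss_moment (mulr_gt0 s0 x0).
    rewrite [X in X%:E](_ : _ = x); last by field; rewrite gt_eqF.
    move=> H; apply: (@Rintegral_le_ge0 _ _ _ _ _
      (fun w => expR (- ((s * x) ^- 2 - s ^- 2) * V w ^+ 2 / 2)) _ i);
      last by rewrite H.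
    - exact: measurable_gauss_factor.
    - by move=> y; exact: expR_ge0.
    - move=> y; apply: le_trans (expR_ge1Dx _); rewrite lerD2l.
      by rewrite /c mulrAC mulNr mulNr.
  rewrite RintegralB// RintegralZl// Rintegral_prob_cst -/m.
  rewrite (_ : c * m = (x ^- 2 - 1) * k); last first.
    by rewrite /c /k; field; rewrite !gt_eqF.
  move=> H; rewrite -(ler_pdivlMr _ _ (exprn_gt0 2 x0)).
  rewrite (_ : _ / _ = (x ^- 2 - 1) * k); first lra.
  by field; rewrite gt_eqF.
suff k12 : k = 1 / 2.
  have -> : m = k * (2 * s ^+ 2) by rewrite /k; field; rewrite gt_eqF.
  by rewrite k12; field.
apply/eqP; rewrite eq_le; apply/andP; split; rewrite leNgt; apply/negP => kh.
(* The tangent inequality at x = 1 + e bounds k from above by x^2 / (1 + x),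
   and at x = 1 - e from below; e is taken small enough to reach 1/2. *)
- pose e := (2 * k - 1) / (2 * k + 2).
  have e0 : 0 < e by rewrite divr_gt0//; lra.
  have eE : e * (2 * k + 2) = 2 * k - 1 by rewrite /e; field; rewrite gt_eqF//; lra.
  clearbody e; have p : 0 < 1 + e by lra.
  have := tangent _ p.
  rewrite (_ : 1 - (1 + e) = - e) ?mulNr ?lerN2; last by ring.
  rewrite -!mulrA ler_pM2l// => H.
  have e1 : e < 1 by nra.
  nra.
- pose e := (1 - 2 * k) / 4.
  have e0 : 0 < e by rewrite divr_gt0//; lra.
  have kE : k = (1 - 4 * e) / 2 by rewrite /e; field.
  clearbody e; have p : 0 < 1 - e by lra.
  have := tangent _ p.
  rewrite (_ : 1 - (1 - e) = e); last by ring.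
  rewrite -!mulrA ler_pM2l// kE => H.
  nra.
Qed.

End normal_law.

(** * Wiener increments and the augmented filtration *)

Section filtration.
Context (d : measure_display) (T : measurableType d) (R : realType).
Variable P : probability T R.

Lemma sub_measurableP (G : set (set T)) (Y : T -> R) :
  sub_measurable <<s G >> Y <->
  measurable_fun setT (Y : g_sigma_algebraType G -> R).
Proof.
split=> [YG _ B mB|YG _ [B mB <-]]; first by apply: YG; exists B.
exact: YG.
Qed.

Lemma events_of_measurable (Y : {RV P >-> R}) : events_of Y `<=` measurable.
Proof. by move=> _ [B mB <-]; exact: measurable_funP. Qed.

Lemma sigma_of_measurable (I : set R) (W : R -> {RV P >-> R}) :
  sigma_of I W `<=` measurable.
Proof.
apply: smallest_sub; first exact: sigma_algebra_measurable.
by move=> A [t It]; exact: events_of_measurable.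
Qed.

Lemma sigma_of_increment (I : set R) (W : R -> {RV P >-> R}) s t :
  I s -> I t -> sub_measurable (sigma_of I W) (fun w => W t w - W s w).
Proof.
move=> Is It; apply/sub_measurableP.
have mW u : I u -> measurable_fun setT
    (W u : g_sigma_algebraType (\bigcup_(u in I) events_of (W u)) -> R).
  by move=> Iu; apply/sub_measurableP => A WA; apply: sub_sigma_algebra; exists u.
by apply: measurable_funB; exact: mW.
Qed.

Lemma subset_sigma_of (I J : set R) (W : R -> {RV P >-> R}) :
  I `<=` J -> sigma_of I W `<=` sigma_of J W.
Proof.
by move=> IJ; apply: sub_sigma_algebra2 => A [u Iu Wu]; exists u => //; exact: IJ.
Qed.

Lemma sigma_ofI (I : set R) (W : R -> {RV P >-> R}) A B :
  sigma_of I W A -> sigma_of I W B -> sigma_of I W (A `&` B).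
Proof.
exact: (@measurableI _ (g_sigma_algebraType (\bigcup_(t in I) events_of (W t)))).
Qed.

(** The class generating [augmented_filtration], named so that T can be equipped
    with that sub-sigma-algebra. *)
Definition augmented_generator (X0 : T -> R) (W : R -> {RV P >-> R}) (t : R) :
    set (set T) :=
  events_of X0 `|` \bigcup_(s in `[0, t]) events_of (W s) `|`
      [set N | measurable N /\ P N = 0%E].

Lemma augmented_generator_measurable (X0 : {RV P >-> R})
    (W : R -> {RV P >-> R}) t :
  augmented_generator X0 W t `<=` measurable.
Proof.
move=> A [[|[s _]]|[]//]; exact: events_of_measurable.
Qed.

Lemma augmented_filtration_measurable (X0 : {RV P >-> R})
    (W : R -> {RV P >-> R}) t :
  augmented_filtration X0 W t `<=` measurable.
Proof.
apply: smallest_sub; first exact: sigma_algebra_measurable.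
exact: augmented_generator_measurable.
Qed.

Lemma augmented_filtrationP (X0 : {RV P >-> R}) (W : R -> {RV P >-> R}) t
    (Y : T -> R) :
  sub_measurable (augmented_filtration X0 W t) Y <->
  measurable_fun setT (Y : g_sigma_algebraType (augmented_generator X0 W t) -> R).
Proof. exact: sub_measurableP. Qed.

Lemma augmented_filtration_le (X0 : {RV P >-> R}) (W : R -> {RV P >-> R}) s t :
  s <= t -> augmented_filtration X0 W s `<=` augmented_filtration X0 W t.
Proof.
move=> st; apply: sub_sigma_algebra2 => A [[XA|[u us WA]]|NA].
- by left; left.
- left; right; exists u => //; move: us; rewrite /= !in_itv/= => /andP[-> us].
  exact: le_trans st.
- by right.
Qed.

Lemma sub_augmented_filtration_measurable (X0 : {RV P >-> R})
    (W : R -> {RV P >-> R}) t (Y : T -> R) :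
  sub_measurable (augmented_filtration X0 W t) Y -> measurable_fun setT Y.
Proof.
move=> YF _ B mB; apply: (@augmented_filtration_measurable X0 W t).
by apply: YF; exists B.
Qed.

(** The intersections of an event of X0 with an event of the past of W, together
    with the null events, form a pi-system generating the filtration, on which
    independence of the increment is a direct computation. *)
Lemma wiener_increment_indep (X0 : {RV P >-> R}) (W : R -> {RV P >-> R}) s t :
  is_wiener W -> indep_of_process X0 W -> 0 <= s -> s < t ->
  indep_classes P (augmented_filtration X0 W s)
    (events_of (fun w => W t w - W s w)).
Proof.
move=> [_ _ Wind _] XW s0 st.
pose Pi := [set A `&` B | A in events_of X0 & B in sigma_of `[0, s] W] `|`
  [set N | measurable N /\ P N = 0%E].
have sigT (I : set R) : sigma_of I W [set: T]
  by exact: (@measurableT _ (g_sigma_algebraType (\bigcup_(t in I) events_of (W t)))).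
have XT : events_of X0 [set: T] by exists setT => //; rewrite setTI preimage_setT.
have PiX A B : events_of X0 A -> sigma_of `[0, s] W B -> Pi (A `&` B).
  by move=> XA WB; left; exists A => //; exists B.
have Pim : Pi `<=` measurable.
  move=> C [[A XA [B WB <-]]|[]//]; apply: measurableI.
    exact: events_of_measurable XA.
  exact: sigma_of_measurable WB.
have genPi : augmented_generator X0 W s `<=` Pi.
  move=> A [[XA|[u us WA]]|NA].
  - by rewrite -[A]setIT; exact: PiX.
  - rewrite -[A]setTI; apply: PiX => //.
    by apply: sub_sigma_algebra; exists u.
  - by right.
have mincr : measurable_fun setT (fun w => W t w - W s w).
  exact: measurable_funB.
move=> A C FA IC.
apply: (@indep_classes_generated _ _ _ P Pi
  (events_of (fun w => W t w - W s w))) => //.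
- move=> A1 A2 P1 P2.
  have mA1 := Pim _ P1; have mA2 := Pim _ P2.
  have null N B : measurable N -> P N = 0%E -> measurable B ->
      Pi (N `&` B).
    move=> mN PN mB; right; split; first exact: measurableI.
    by apply: subset_measure0 PN => //; exact: measurableI.
  case: P1 => [[A11 XA11 [B1 WB1 E1]]|[mN PN]]; last exact: null.
  case: P2 => [[A12 XA12 [B2 WB2 E2]]|[mN PN]]; last first.
    by rewrite setIC; exact: null.
  rewrite -E1 -E2 setIACA; apply: PiX.
    case: XA11 => D1 mD1 <-; case: XA12 => D2 mD2 <-.
    exists (D1 `&` D2); first exact: measurableI.
    by rewrite preimage_setI setIACA setIid.
  exact: sigma_ofI.
- by rewrite -[setT]setIT; exact: PiX.
- by move=> _ [B mB <-]; exact: mincr.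
- move=> A' C' [[A1 XA1 [B WB <-]]|[mN PN]] IC'.
    have mA1 := events_of_measurable XA1.
    have WBoo : sigma_of `[0, +oo[ W B.
      apply: subset_sigma_of WB => u; rewrite /= !in_itv/= andbT.
      by move=> /andP[].
    have WCoo : sigma_of `[0, +oo[ W C'.
      apply: (@sigma_of_increment _ W s t) => //=; rewrite in_itv/= andbT//.
      by rewrite (le_trans s0)// ltW.
    rewrite -setIA XW//; last exact: sigma_ofI.
    rewrite (XW A1 B)// -[RHS]muleA; congr (_ * _)%E.
    by rewrite setIC (Wind s t)// muleC.
  have mC : measurable C' by case: IC' => B mB <-; exact: mincr.
  rewrite PN mul0e; apply: subset_measure0 PN => //; exact: measurableI.
- by apply: sub_sigma_algebra2 FA => X gX; exact: genPi.
Qed.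

End filtration.

Section exponential_step.
Context (d : measure_display) (T : measurableType d) (R : realType).
Variables (P : probability T R) (X0 : {RV P >-> R}) (W : R -> {RV P >-> R}).
Hypotheses (hW : is_wiener W) (hind : indep_of_process X0 W).

(** The conditional exponential moment of a Wiener increment, in the form of the
    martingale property of exp(int xi dW - 1/2 int xi^2 ds). *)
Lemma wiener_exp_step (s t : R) (xi Z : T -> R) :
  0 <= s -> s <= t ->
  sub_measurable (augmented_filtration X0 W s) xi ->
  sub_measurable (augmented_filtration X0 W s) Z -> (forall w, 0 <= Z w) ->
  (\int[P]_w (Z w * expR (xi w * (W t w - W s w) - xi w ^+ 2 * (t - s) / 2))%:E
   = \int[P]_w (Z w)%:E)%E.
Proof.
move=> s0; rewrite le_eqVlt => /predU1P[<- _ _ _|st].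
  apply: eq_integral => w _.
  by rewrite !subrr !mulr0 mul0r subrr expR0 mulr1.
move=> /augmented_filtrationP mxi /augmented_filtrationP mZ Z0.
pose G := augmented_generator X0 W s.
pose V w := W t w - W s w.
have mV : measurable_fun setT V by exact: measurable_funB.
pose f (z : g_sigma_algebraType G * R) : \bar R :=
  (Z z.1 * expR (xi z.1 * z.2 - xi z.1 ^+ 2 * (t - s) / 2))%:E.
have mZ1 : measurable_fun setT (fun z : g_sigma_algebraType G * R => Z z.1).
  exact: measurableT_comp mZ measurable_fst.
have mx1 : measurable_fun setT (fun z : g_sigma_algebraType G * R => xi z.1).
  exact: measurableT_comp mxi measurable_fst.
have mf : measurable_fun setT f.
  apply/measurable_EFinP; apply: measurable_funM => //.
  apply/measurableT_comp => //; apply: measurable_funB.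
    by apply: measurable_funM => //; exact: measurable_snd.
  by do 2 apply: measurable_funM => //; exact: measurable_funX.
have f0 z : (0 <= f z)%E by rewrite lee_fin mulr_ge0 ?expR_ge0.
transitivity (\int[P]_w f (w, V w))%E; first by [].
rewrite (@ge0_integral_indep_sigma _ _ _ P G)//; last first.
- exact: wiener_increment_indep.
- exact: augmented_generator_measurable.
have ts0 : 0 < t - s by rewrite subr_gt0.
have r0 : 0 < Num.sqrt (t - s) by rewrite sqrtr_gt0.
have lawV B : measurable B -> P (V @^-1` B) = normal_prob 0 (Num.sqrt (t - s)) B.
  by case: hW => _ _ _ Wlaw; exact: Wlaw.
apply: eq_integral => w _; rewrite /f/=.
under eq_integral do rewrite EFinM.
have := normal_law_exp_moment mV r0 lawV (xi w).
rewrite sqr_sqrtr ?ltW// => E.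
rewrite ge0_integralZl ?E ?mule1 ?lee_fin//.
  apply/measurable_EFinP/measurableT_comp => //; apply: measurable_funB => //.
  exact: measurable_funM.
Qed.

End exponential_step.

(** * The mean of the theta-Milstein scheme *)

Section scheme.
Context (d : measure_display) (T : measurableType d) (R : realType).
Variables (P : probability T R) (alpha mu sigma theta Delta : R)
  (W : R -> {RV P >-> R}) (X0 : {RV P >-> R}).
Hypotheses (alpha0 : 0 < alpha) (theta1 : 1 <= theta) (Delta0 : 0 < Delta)
  (hW : is_wiener W) (X0int : P.-integrable setT (EFin \o X0))
  (hind : indep_of_process X0 W).

Local Notation X := (theta_milstein alpha mu sigma theta Delta W X0).
Local Notation dW n w := (W (n.+1%:R * Delta) w - W (n%:R * Delta) w).

Lemma measurable_fun_sqrt d' (T' : measurableType d') (f : T' -> R) :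
  measurable_fun setT f -> measurable_fun setT (fun w => Num.sqrt (f w)).
Proof.
move=> mf; apply: (measurableT_comp _ mf).
by apply: continuous_measurable_fun => x; exact: sqrt_continuous.
Qed.

Lemma theta_milstein_adapted n :
  sub_measurable (augmented_filtration X0 W (n%:R * Delta)) (X n).
Proof.
elim: n => [|n IH].
  by move=> A XA; apply: sub_sigma_algebra; left; left.
have le_t : n%:R * Delta <= n.+1%:R * Delta.
  by rewrite ler_pM2r// ler_nat.
have mX : sub_measurable (augmented_filtration X0 W (n.+1%:R * Delta)) (X n).
  by move=> A /IH; exact: augmented_filtration_le.
have mW u : 0 <= u <= n.+1%:R * Delta ->
    sub_measurable (augmented_filtration X0 W (n.+1%:R * Delta)) (W u).
  move=> hu A WA; apply: sub_sigma_algebra; left; right; exists u => //.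
move: mX => /augmented_filtrationP mX.
have /augmented_filtrationP mW1 := mW (n.+1%:R * Delta) ltac:(
  by rewrite lexx andbT mulr_ge0// ltW).
have /augmented_filtrationP mW0 := mW (n%:R * Delta) ltac:(
  by rewrite le_t andbT mulr_ge0// ltW).
apply/augmented_filtrationP => /=.
have mdW := measurable_funB mW1 mW0.
apply: measurable_funM => //; apply: measurable_funD.
  apply: measurable_funD; last first.
    by do 2 apply: measurable_funM => //; exact: measurable_fun_sqrt.
  by apply: measurable_funD => //; exact: measurable_funM.
by apply: measurable_funM => //; exact: measurable_funX.
Qed.

Lemma measurable_theta_milstein n : measurable_fun setT (X n).
Proof.
exact: (@sub_augmented_filtration_measurable _ _ _ P X0 W _ _
  (@theta_milstein_adapted n)).
Qed.

Lemma sqr_sqrtr_le (x : R) : Num.sqrt x ^+ 2 <= `|x|.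
Proof.
have [x0|x0] := leP 0 x; first by rewrite sqr_sqrtr// ler_norm.
by rewrite ler0_sqrtr; [rewrite expr2 mulr0 normr_ge0|exact: ltW].
Qed.

Lemma milstein_increment_sqr n :
  P.-integrable setT (EFin \o (fun w => dW n w ^+ 2)) /\
  \int[P]_w (dW n w ^+ 2) = Delta.
Proof.
have lt_t : n%:R * Delta < n.+1%:R * Delta by rewrite ltr_pM2r// ltr_nat.
have DE : n.+1%:R * Delta - n%:R * Delta = Delta.
  by rewrite -mulrBl -natrB// subSnn mul1r.
have mV : measurable_fun setT (fun w => dW n w) by exact: measurable_funB.
have r0 : 0 < Num.sqrt Delta by rewrite sqrtr_gt0.
have lawV B : measurable B -> P ((fun w => dW n w) @^-1` B) =
    normal_prob 0 (Num.sqrt Delta) B.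
  case: hW => _ _ _ Wlaw mB; rewrite -[in RHS]DE; apply: Wlaw => //.
  by rewrite mulr_ge0// ltW.
split; first exact: (normal_law_integrable_sqr mV r0 lawV).
by rewrite (normal_law_second_moment mV r0 lawV) sqr_sqrtr// ltW.
Qed.

(** Since sqrt(x)^2 <= |x|, integrability of X n makes sqrt(X n) times the
    increment integrable, and [wiener_exp_step] with xi = l sqrt(X n) provides
    its exponential bounds. *)
Lemma milstein_noise_mean0 n : P.-integrable setT (EFin \o X n) ->
  P.-integrable setT (EFin \o (fun w => Num.sqrt (X n w) * dW n w)) /\
  \int[P]_w (Num.sqrt (X n w) * dW n w) = 0.
Proof.
move=> iX.
have mX := measurable_theta_milstein n.
have msX := measurable_fun_sqrt mX.
have mV : measurable_fun setT (fun w => dW n w) by exact: measurable_funB.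
have [iV _] := milstein_increment_sqr n.
have inX : P.-integrable setT (EFin \o (fun w => `|X n w|)).
  exact: integrable_norm iX.
have iY : P.-integrable setT (EFin \o (fun w => Num.sqrt (X n w) * dW n w)).
  apply: (@integrable_le _ _ _ P _ (fun w => `|X n w| + dW n w ^+ 2)).
  - exact: measurable_funM.
  - move=> w; apply: le_trans (lerD (sqr_sqrtr_le (X n w)) (lexx _)).
    set a := Num.sqrt _; set b := _ - _.
    rewrite normrM -(real_normK (num_real a)) -(real_normK (num_real b)).
    by have := normr_ge0 a; have := normr_ge0 b; nra.
  - by apply: eq_integrable (integrableD measurableT inX iV).
split=> //.
have iZ : P.-integrable setT
    (EFin \o (fun w => Num.sqrt (X n w) ^+ 2 * Delta / 2)).
  apply: (@integrable_le _ _ _ P _ (fun w => Delta / 2 * `|X n w|)).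
  - by do 2 apply: measurable_funM => //; exact: measurable_funX.
  - move=> w; rewrite ger0_norm; last first.
      by rewrite divr_ge0// mulr_ge0 ?sqr_ge0// ltW.
    rewrite mulrC -[_ ^+ 2 * _]mulrC mulrA [_^-1 * _]mulrC.
    by rewrite ler_wpM2l ?sqr_sqrtr_le// divr_ge0// ltW.
  - by apply: eq_integrable (integrableZl measurableT (Delta / 2) inX).
apply: (exp_supermartingale_mean0 iY iZ) => l.
have lt_t : n%:R * Delta <= n.+1%:R * Delta by rewrite ler_pM2r// ler_nat.
have DE : n.+1%:R * Delta - n%:R * Delta = Delta.
  by rewrite -mulrBl -natrB// subSnn mul1r.
have nD0 : 0 <= n%:R * Delta by rewrite mulr_ge0// ltW.
have := @wiener_exp_step _ _ _ P X0 W hW hind _ _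
  (fun w => l * Num.sqrt (X n w)) (cst 1) nD0 lt_t.
have I1 : (\int[P]_w (cst (1 : R) w)%:E = 1)%E.
  transitivity (\int[P]_w (cst 1%E w))%E => //.
  by rewrite integral_cst// mul1e; exact: probability_setT.
rewrite DE I1 => H.
under eq_integral => w _.
  rewrite (_ : _ - _ = l * Num.sqrt (X n w) * dW n w
    - (l * Num.sqrt (X n w)) ^+ 2 * Delta / 2); last first.
    by rewrite exprMn; ring.
  rewrite -[expR _]mul1r.
  over.
rewrite [leLHS]H//.
- apply/augmented_filtrationP; apply: measurable_funM => //.
  apply: measurable_fun_sqrt; apply/augmented_filtrationP.
  exact: theta_milstein_adapted.
- by apply/augmented_filtrationP; exact: measurable_cst.
Qed.

Local Notation r := ((1 + alpha * (theta - 1) * Delta) / (1 + alpha * theta * Delta)).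

(** The sigma^2/4 Delta subtracted in the drift is exactly compensated by the mean
    of the squared increment, which leaves a recursion with fixed point mu. *)
Lemma milstein_mean_step n : P.-integrable setT (EFin \o X n) ->
  P.-integrable setT (EFin \o X n.+1) /\
  \int[P]_w X n.+1 w - mu = r * (\int[P]_w X n w - mu).
Proof.
move=> iX.
have [iY EY] := milstein_noise_mean0 iX.
have [iV EV] := milstein_increment_sqr n.
set k := (1 + alpha * theta * Delta)^-1.
set a := 1 - alpha * Delta + alpha * theta * Delta.
set b := (alpha * mu - sigma ^+ 2 / 4) * Delta.
have i1 : P.-integrable setT (EFin \o (fun w => a * X n w)).
  by apply: eq_integrable (integrableZl measurableT a iX).
have i2 : P.-integrable setT (EFin \o (fun=> b)).
  exact: finite_measure_integrable_cst.
have i12 : P.-integrable setT (EFin \o (fun w => a * X n w + b)).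
  by apply: eq_integrable (integrableD measurableT i1 i2).
have i3 : P.-integrable setT
    (EFin \o (fun w => sigma * (Num.sqrt (X n w) * dW n w))).
  by apply: eq_integrable (integrableZl measurableT sigma iY).
have i123 : P.-integrable setT (EFin \o
    (fun w => a * X n w + b + sigma * (Num.sqrt (X n w) * dW n w))).
  by apply: eq_integrable (integrableD measurableT i12 i3).
have i4 : P.-integrable setT (EFin \o (fun w => sigma ^+ 2 / 4 * dW n w ^+ 2)).
  by apply: eq_integrable (integrableZl measurableT (sigma ^+ 2 / 4) iV).
have i1234 : P.-integrable setT (EFin \o
    (fun w => a * X n w + b + sigma * (Num.sqrt (X n w) * dW n w)
      + sigma ^+ 2 / 4 * dW n w ^+ 2)).
  by apply: eq_integrable (integrableD measurableT i123 i4).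
have XE : X n.+1 = fun w => k *
    (a * X n w + b + sigma * (Num.sqrt (X n w) * dW n w)
      + sigma ^+ 2 / 4 * dW n w ^+ 2).
  by apply/funext => w; rewrite [sigma * (_ * _)]mulrA.
rewrite XE; split.
  by apply: eq_integrable (integrableZl measurableT k i1234).
rewrite RintegralZl// RintegralD// RintegralD// RintegralD// Rintegral_prob_cst.
rewrite !RintegralZl// EY EV /k /a /b; field.
by rewrite gt_eqF// addr_gt0// !mulr_gt0// (lt_le_trans ltr01).
Qed.

Lemma theta_milstein_mean n : P.-integrable setT (EFin \o X n) /\
  \int[P]_w X n w = mu + r ^+ n * (\int[P]_w X0 w - mu).
Proof.
elim: n => [|n [iX IH]]; first by split=> //; rewrite expr0 mul1r addrC subrK.
have [iX1 E] := milstein_mean_step iX; split=> //.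
by rewrite -[LHS](subrK mu) E IH exprS; ring.
Qed.

Lemma theta_milstein_mean_cvg :
  ('E_P[X n] @[n --> \oo] --> mu%:E)%E.
Proof.
have den0 : 0 < 1 + alpha * theta * Delta.
  by rewrite addr_gt0// !mulr_gt0// (lt_le_trans ltr01).
have num0 : 0 < 1 + alpha * (theta - 1) * Delta.
  by rewrite ltr_wpDr// !mulr_ge0 ?subr_ge0// ltW.
have r1 : `|r| < 1.
  rewrite ger0_norm; last by rewrite divr_ge0// ltW.
  by rewrite ltr_pdivrMr// mul1r ltrD2l; have := mulr_gt0 alpha0 Delta0; nra.
rewrite (_ : (fun n => 'E_P[X n]%E) = EFin \o
    (fun n => mu + r ^+ n * (\int[P]_w X0 w - mu))).
  apply: cvg_EFin; first by near=> n.
  rewrite -[X in _ --> X]addr0; apply: cvgD; first exact: cvg_cst.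
  rewrite -[X in _ --> X](mul0r (\int[P]_w X0 w - mu)).
  by apply: cvgM; [exact: cvg_expr|exact: cvg_cst].
apply/funext => n /=; rewrite unlock.
have [iX <-] := theta_milstein_mean n.
by rewrite /Rintegral fineK//; exact: integrable_fin_num iX.
Unshelve. all: by end_near. Qed.

End scheme.

(** * Fatou's lemma in probability for exponentials *)

Lemma minr_le_l (R : realDomainType) (x y : R) : Num.min x y <= x.
Proof. by rewrite ge_min lexx. Qed.

Lemma minr_le_r (R : realDomainType) (x y : R) : Num.min x y <= y.
Proof. by rewrite ge_min lexx orbT. Qed.

Section fatou_in_probability.
Context (d : measure_display) (T : measurableType d) (R : realType).
Variable P : probability T R.

(** Off B n the variable exp Y is at most exp e times exp (Yn n); on B n the
    truncation level K bounds it, at a cost K * P (B n) that vanishes. *)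
Lemma exp_truncation_le1 (Y : T -> R) (Yn : nat -> T -> R) (K : R) :
  0 <= K -> measurable_fun setT Y -> (forall n, measurable_fun setT (Yn n)) ->
  (forall n, (\int[P]_w (expR (Yn n w))%:E <= 1)%E) ->
  (forall e, 0 < e -> exists B : nat -> set T,
    [/\ forall n, measurable (B n), P (B n) @[n --> \oo] --> 0%E &
        forall n w, ~ B n w -> Y w <= Yn n w + e]) ->
  (\int[P]_w (Num.min (expR (Y w)) K)%:E <= 1)%E.
Proof.
move=> K0 mY mYn En H; apply/lee_addgt0Pr => eta eta0.
pose e := ln (1 + eta / 2).
(* e and del each contribute eta / 2 to the error. *)
have e1 : 1 < 1 + eta / 2 by rewrite ltrDl divr_gt0.
have e0 : 0 < e by rewrite ln_gt0.
have expe : expR e = 1 + eta / 2 by rewrite lnK// posrE (lt_trans ltr01).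
have [B [mB + YB]] := H e e0.
pose del := eta / 2 / (K + 1).
have K1 : 0 < K + 1 by rewrite ltr_wpDl.
have del0 : 0 < del by rewrite !divr_gt0.
move=> /fine_cvgP[_ /cvgrPdist_lt /(_ del del0)] [n _ /(_ n (leqnn n))] /=.
rewrite sub0r normrN ger0_norm ?fine_ge0// => PBn.
have fK w : Num.min (expR (Y w)) K <=
    expR e * expR (Yn n w) + K * \1_(B n) w.
  rewrite indicE; have [_|/negP wB] := boolP (w \in B n).
    rewrite mulr1 (le_trans (minr_le_r _ _))// ?lerDr ?mulr_ge0 ?expR_ge0//.
  rewrite mulr0 addr0 (le_trans (minr_le_l _ _))// -expRD ler_expR addrC.
  by apply: YB => Bw; apply: wB; rewrite inE.
have mexpY : measurable_fun setT (fun w => expR (Y w)) by exact: measurableT_comp.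
have mexpYn : measurable_fun setT (fun w => expR (Yn n w)).
  exact: measurableT_comp.
apply: (@le_trans _ _ (\int[P]_w
    ((expR e)%:E * (expR (Yn n w))%:E + K%:E * (\1_(B n) w)%:E))%E).
  apply: ge0_le_integral => //.
  - by move=> w _; rewrite lee_fin le_min expR_ge0.
  - by apply/measurable_EFinP; exact: measurable_minr.
  - by apply: emeasurable_funD; apply/measurable_EFinP;
      apply: measurable_funM => //; exact: measurable_indic.
  - by move=> w _; rewrite -!EFinM -EFinD lee_fin.
rewrite ge0_integralD//; last 3 first.
- by apply/measurable_EFinP; exact: measurable_funM.
- by move=> w _; rewrite -EFinM lee_fin mulr_ge0.
- by apply/measurable_EFinP; apply: measurable_funM => //; exact: measurable_indic.
rewrite ge0_integralZl//; last first.
- exact/measurable_EFinP.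
rewrite ge0_integralZl//; last first.
- by apply/measurable_EFinP; exact: measurable_indic.
rewrite integral_indic// setIT.
apply: (@le_trans _ _ ((expR e)%:E * 1 + K%:E * (fine (P (B n)))%:E)%E).
  rewrite fineK ?fin_num_measure//.
  by apply: leeD => //; apply: lee_wpmul2l => //; rewrite lee_fin expR_ge0.
rewrite mule1 -EFinM -EFinD lee_fin expe.
have : K * fine (P (B n)) <= eta / 2.
  have -> : eta / 2 = (K + 1) * del by rewrite /del; field; rewrite gt_eqF.
  apply: ler_pM => //; first by rewrite fine_ge0.
    by rewrite lerDl.
  exact: ltW.
lra.
Qed.

(** Fatou's lemma for convergence in probability, in the one-sided form needed
    below: Y need only be dominated, up to a small error and off an event of
    vanishing probability, by the Yn. *)
Lemma exp_le1_in_probability (Y : T -> R) (Yn : nat -> T -> R) :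
  measurable_fun setT Y -> (forall n, measurable_fun setT (Yn n)) ->
  (forall n, (\int[P]_w (expR (Yn n w))%:E <= 1)%E) ->
  (forall e, 0 < e -> exists B : nat -> set T,
    [/\ forall n, measurable (B n), P (B n) @[n --> \oo] --> 0%E &
        forall n w, ~ B n w -> Y w <= Yn n w + e]) ->
  (\int[P]_w (expR (Y w))%:E <= 1)%E.
Proof.
move=> mY mYn En H.
pose g (k : nat) w := (Num.min (expR (Y w)) k%:R)%:E.
have mexpY : measurable_fun setT (fun w => expR (Y w)) by exact: measurableT_comp.
have -> : (\int[P]_w (expR (Y w))%:E = \int[P]_w (limn (g^~ w)))%E.
  apply: eq_integral => w _; apply/esym/cvg_lim => //.
  apply: cvg_near_cst; near=> k; rewrite /g min_l//.
  by near: k; exact: nbhs_infty_ger.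
rewrite monotone_convergence//; last 3 first.
- by move=> k; apply/measurable_EFinP; exact: measurable_minr.
- by move=> k w _; rewrite lee_fin le_min expR_ge0/=.
- move=> w _ m n mn; rewrite lee_fin le_min minr_le_l/=.
  by rewrite (le_trans (minr_le_r _ _))// ler_nat.
apply: lime_le; last by near=> k; exact: (exp_truncation_le1 _ mY mYn).
apply: ereal_nondecreasing_is_cvgn => m n mn; apply: ge0_le_integral => //.
- by move=> w _; rewrite lee_fin le_min expR_ge0/=.
- by apply/measurable_EFinP; exact: measurable_minr.
- by apply/measurable_EFinP; exact: measurable_minr.
- move=> w _; rewrite lee_fin le_min minr_le_l/=.
  by rewrite (le_trans (minr_le_r _ _))// ler_nat.
Unshelve. all: by end_near. Qed.

End fatou_in_probability.

(** * Exponential martingales of simple processes *)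

Section simple_integral.
Context (d : measure_display) (T : measurableType d) (R : realType).
Variables (P : probability T R) (X0 : {RV P >-> R}) (W : R -> {RV P >-> R}).
Hypotheses (hW : is_wiener W) (hind : indep_of_process X0 W).
Local Notation F := (augmented_filtration X0 W).
Variable H : simple_process F.

Lemma sp_time_le i j : (i <= j)%N -> sp_time H i <= sp_time H j.
Proof.
move=> /subnK<-; elim: (j - i)%N => // k IH.
exact: le_trans IH (sp_time_nd _ _).
Qed.

(** The integral over [0, t] of the square of the simple process, in the form in
    which it appears along the partition; see [integral_sqr_step_sum]. *)
Definition sp_qv (t : R) (w : T) : R :=
  \sum_(i < sp_size H)
    sp_coef H i w ^+ 2 * (Num.min (sp_time H i.+1) t - Num.min (sp_time H i) t).

(** The logarithm of the exponential martingale of l * H stopped at t, after the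
    first n steps of the partition. *)
Definition sp_log (l t : R) (n : nat) (w : T) : R := \sum_(i < n)
   (l * sp_coef H i w * (W (Num.min (sp_time H i.+1) t) w
                     - W (Num.min (sp_time H i) t) w)
    - (l * sp_coef H i w) ^+ 2
      * (Num.min (sp_time H i.+1) t - Num.min (sp_time H i) t) / 2).

Lemma sp_logE l t w : sp_log l t (sp_size H) w =
  l * sp_integral W H t w - l ^+ 2 / 2 * sp_qv t w.
Proof.
rewrite /sp_log /sp_integral /sp_qv !mulr_sumr -sumrB.
by apply: eq_bigr => i _; ring.
Qed.

Lemma sp_log_adapted l t n : 0 <= t ->
  sub_measurable (F (sp_time H n)) (sp_log l t n).
Proof.
move=> t0; apply/augmented_filtrationP; apply: measurable_sum => i.
have mW u : 0 <= u <= sp_time H n ->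
    measurable_fun setT (W u : g_sigma_algebraType
      (augmented_generator X0 W (sp_time H n)) -> R).
  move=> hu; apply/augmented_filtrationP => A WA.
  by apply: sub_sigma_algebra; left; right; exists u.
have mWm j : (j <= n)%N -> measurable_fun setT
    (W (Num.min (sp_time H j) t) : g_sigma_algebraType
      (augmented_generator X0 W (sp_time H n)) -> R).
  move=> jn; apply: mW.
  by rewrite le_min sp_time_ge0 t0/= (le_trans (minr_le_l _ _))// sp_time_le.
have mc : measurable_fun setT (sp_coef H i : g_sigma_algebraType
      (augmented_generator X0 W (sp_time H n)) -> R).
  apply/augmented_filtrationP => A /sp_coef_adapted.
  by apply: augmented_filtration_le; exact/sp_time_le/ltnW.
apply: measurable_funB.
  apply: measurable_funM; first exact: measurable_funM.
  by apply: measurable_funB; apply: mWm => //; exact: ltnW.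
by do 2 apply: measurable_funM => //; apply: measurable_funX; exact: measurable_funM.
Qed.

(** One step of the partition at a time: the exponential of the first n steps is
    known at time [sp_time H n], so [wiener_exp_step] removes step n. *)
Lemma simple_exp_moment l t : 0 <= t ->
  (\int[P]_w (expR (l * sp_integral W H t w - l ^+ 2 / 2 * sp_qv t w))%:E = 1)%E.
Proof.
move=> t0; under eq_integral do rewrite -sp_logE.
elim: (sp_size H) => [|n IH].
  under eq_integral do rewrite /sp_log big_ord0 expR0.
  rewrite (_ : (fun=> 1%:E) = cst 1%E)// integral_cst// mul1e.
  exact: probability_setT.
(* Once t is passed, the stopped increments vanish. *)
have [tn|tn] := leP t (sp_time H n).
  rewrite -IH; apply: eq_integral => w _.
  rewrite /sp_log big_ord_recr/= !min_r// ?subrr ?mulr0 ?mul0r ?subr0 ?addr0//.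
  exact: le_trans tn (sp_time_nd _ _).
rewrite -[RHS]IH.
pose s := sp_time H n; pose u := Num.min (sp_time H n.+1) t.
have su : s <= u by rewrite le_min sp_time_nd ltW.
rewrite -[RHS](@wiener_exp_step _ _ _ P X0 W hW hind s u
  (fun w => l * sp_coef H n w) (fun w => expR (sp_log l t n w)))//.
- apply: eq_integral => w _; rewrite -expRD; congr (EFin (expR _)).
  by rewrite /sp_log big_ord_recr/= (min_l (ltW tn)).
- exact: sp_time_ge0.
- apply/augmented_filtrationP; apply: measurable_funM => //.
  by apply/augmented_filtrationP; exact: sp_coef_adapted.
- apply/augmented_filtrationP; apply: measurableT_comp => //.
  by apply/augmented_filtrationP; exact: sp_log_adapted.
Qed.

End simple_integral.

(** * Time integrals of continuous processes *)

Section joint_measurability.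
Context (d : measure_display) (T : measurableType d) (R : realType).

(** Freezing a path at its initial value for negative times turns continuity on
    the half-line into continuity on the whole line. *)
Lemma continuous_halfline_extension (f : R -> R) :
  {within `[0, +oo[, continuous f} ->
  continuous (fun s : R => f (Num.max s 0)).
Proof.
move=> /subspace_continuousP cf; move=> x0'; set x : R := x0'.
have x0 : `[0, +oo[%classic (Num.max x 0).
  by rewrite /= in_itv/= andbT le_max lexx orbT.
apply: (cvg_comp (fun s => Num.max s 0) f _ (cf _ x0)).
move=> A; rewrite /within/= => xA.
have cm : continuous (fun s : R => Num.max s 0 : R).
  by move=> y; apply: continuous_max; [exact: cvg_id|exact: cvg_cst].
move: (cm x _ xA); apply: (@filterS _ (nbhs x) _
  (fun s => `[0, +oo[%classic (Num.max s 0) -> A (Num.max s 0))) => s; apply.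
by rewrite /= in_itv/= andbT le_max lexx orbT.
Qed.

(** A process with continuous paths is the limit of the processes that it
    induces on the grids of mesh 1 / (k + 1), and these are jointly measurable
    because they involve countably many times only. *)
Lemma measurable_continuous_process (X : R -> T -> R) :
  (forall s, 0 <= s -> measurable_fun setT (X s)) ->
  (forall w, {within `[0, +oo[, continuous (X ^~ w)}) ->
  measurable_fun setT
    (fun z : T * measurableTypeR R => X (Num.max z.2 0) z.1).
Proof.
move=> mX cX.
pose N k (s : R) := Num.truncn (Num.max s 0 * k.+1%:R).
pose g k (z : T * measurableTypeR R) := X ((N k z.2)%:R / k.+1%:R) z.1.
apply: (@measurable_fun_cvg _ _ _ setT g).
- move=> k _ B mB; rewrite setTI.
  have -> : g k @^-1` B = \bigcup_n
      ((fun z : T * measurableTypeR R => X (n%:R / k.+1%:R) z.1) @^-1` B `&`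
       (fun z : T * measurableTypeR R => Num.max z.2 0 * k.+1%:R)
          @^-1` `[n%:R, n.+1%:R[).
    apply/seteqP; split=> [z gz|z [n _ [/= Bz]]].
      exists (N k z.2) => //; split=> //=.
      by rewrite in_itv/= truncn_itv// mulr_ge0// le_max lexx orbT.
    rewrite in_itv/= -truncn_eq; last by rewrite mulr_ge0// le_max lexx orbT.
    by move=> /eqP E; rewrite /g /N E.
  apply: bigcup_measurable => n _; apply: measurableI.
    rewrite -[X in measurable X]setTI.
    by apply: (measurableT_comp (mX _ _) measurable_fst) => //; rewrite divr_ge0.
  rewrite -[X in measurable X]setTI.
  have m2 : measurable_fun setT (fun z : T * measurableTypeR R => (z.2 : R)).
    exact: (@measurable_snd _ _ T (measurableTypeR R)).
  have : measurable_fun setT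
      (fun z : T * measurableTypeR R => Num.max z.2 0 * k.+1%:R).
    by apply: measurable_funM => //; exact: measurable_maxr.
  by apply => //; exact: measurable_itv.
- move=> [w s] _ /=.
  pose h r := X (Num.max r 0) w.
  have ch : continuous h := continuous_halfline_extension (cX w).
  pose a := Num.max s 0; have a0 : 0 <= a by rewrite le_max lexx orbT.
  rewrite (_ : X a w = h a); last by rewrite /h (max_l a0).
  rewrite (_ : (fun k => g k (w, s)) = h \o (fun k => (N k s)%:R / k.+1%:R));
    last first.
    by apply/funext => k; rewrite /h/= max_l// divr_ge0.
  apply: continuous_cvg; first exact: ch.
  apply/cvgrPdist_lt => e e0; near=> k.
  have k0 : 0 < k.+1%:R :> R by [].
  have /andP[lo hi] := truncn_itv (mulr_ge0 a0 (ltW k0)).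
  apply: (@le_lt_trans _ _ k.+1%:R^-1).
    rewrite ger0_norm; last by rewrite subr_ge0 ler_pdivrMr.
    rewrite lerBlDr -[X in _ <= X + _]mul1r -mulrDl ler_pdivlMr// nat1r.
    exact: ltW.
  near: k; exact: (near_infty_natSinv_lt (PosNum e0)).
Unshelve. all: by end_near. Qed.
End joint_measurability.

Section simple_square.
Context (R : realType).
Local Notation mu := (@lebesgue_measure R).
Variables (u c : nat -> R).
Hypothesis und : forall i, u i <= u i.+1.

(** At most one of the consecutive intervals contains s, so the mixed terms of
    the square vanish. *)
Lemma sqr_step_sum n (s : R) :
  (\sum_(i < n) c i * (\1_(`[u i, u i.+1[) s : R)) ^+ 2 =
  \sum_(i < n) c i ^+ 2 * (\1_(`[u i, u i.+1[) s : R).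
Proof.
have ule i j : (i <= j)%N -> u i <= u j.
  by move=> /subnK<-; elim: (j - i)%N => // k IH; exact: le_trans IH (und _).
elim: n => [|n IH]; first by rewrite !big_ord0 expr0n.
rewrite !big_ord_recr/= sqrrD IH.
have [sn|sn] := boolP (s \in (`[u n, u n.+1[)%classic); last first.
  by rewrite indicE (negbTE sn) !mulr0 mul0rn expr0n/= !addr0.
rewrite big1 => [|i _]; last first.
  rewrite indicE; case: (boolP (s \in _)) => [|_]; last by rewrite mulr0.
  move: sn; rewrite !inE/= !in_itv/= => /andP[un _] /andP[_ ui].
  by have := lt_le_trans ui (le_trans (ule i.+1 n (ltn_ord i)) un); rewrite ltxx.
rewrite [X in X *+ 2](_ : _ = 0); last first.
  rewrite big1 ?mul0r// => i _.
  rewrite indicE; case: (boolP (s \in _)) => [|_]; last by rewrite mulr0.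
  move: sn; rewrite !inE/= !in_itv/= => /andP[un _] /andP[_ ui].
  by have := lt_le_trans ui (le_trans (ule i.+1 n (ltn_ord i)) un); rewrite ltxx.
by rewrite mul0rn !add0r indicE sn !mulr1.
Qed.

Lemma measure_step_interval (a b t : R) : 0 <= a -> a <= b -> 0 <= t ->
  mu (`[a, b[ `&` `[0, t]) = (Num.min b t - Num.min a t)%:E.
Proof.
move=> a0 ab t0; have [ta|at_] := ltP t a.
  rewrite (min_r (le_trans (ltW ta) ab)) subrr.
  rewrite (_ : _ `&` _ = set0) ?measure0//; apply/seteqP; split=> // s [/=].
  rewrite !in_itv/= => /andP[as_ _] /andP[_ st].
  by have := lt_le_trans ta (le_trans as_ st); rewrite ltxx.
have [bt|tb] := leP b t.
  rewrite (_ : _ `&` _ = `[a, b[%classic); last first.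
    apply/seteqP; split=> [s [//]|s /= ]; rewrite !in_itv/= => /andP[as_ sb].
    by rewrite as_ sb (le_trans a0)//= (le_trans (ltW sb)).
  rewrite lebesgue_measure_itv/= lte_fin; case: ltP => // ba.
  by rewrite (@le_anti _ _ a b) ?subrr// ab ba.
rewrite (_ : _ `&` _ = `[a, t]%classic); last first.
  apply/seteqP; split=> s /=; rewrite !in_itv/=.
    by move=> [/andP[-> _] /andP[_ ->]].
  move=> /andP[as_ st]; rewrite as_ st (le_lt_trans st tb); split=> //.
  by rewrite (le_trans a0).
rewrite lebesgue_measure_itv/= lte_fin; case: ltP => // ta.
by rewrite (@le_anti _ _ a t) ?subrr// at_ ta.
Qed.

Hypothesis u0 : forall i, 0 <= u i.

Lemma integral_sqr_step_sum n (t : R) : 0 <= t ->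
  (\int[mu]_(s in `[0%R, t])
     ((\sum_(i < n) c i * (\1_(`[u i, u i.+1[) s : R)) ^+ 2)%:E =
   (\sum_(i < n) c i ^+ 2 * (Num.min (u i.+1) t - Num.min (u i) t))%:E)%E.
Proof.
move=> t0; under eq_integral do rewrite sqr_step_sum -sumEFin.
rewrite ge0_integral_sum//; last 2 first.
- move=> i; apply/measurable_EFinP; apply: measurable_funTS.
  by apply: measurable_funM => //; exact: measurable_indic.
- by move=> i s _; rewrite lee_fin mulr_ge0 ?sqr_ge0.
rewrite -sumEFin; apply: eq_bigr => i _.
under eq_integral do rewrite EFinM.
rewrite ge0_integralZl//; last first.
- by rewrite lee_fin sqr_ge0.
- by apply/measurable_EFinP; apply: measurable_funTS; exact: measurable_indic.
by rewrite integral_indic// [RHS]EFinM -measure_step_interval.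
Qed.

End simple_square.

Section time_integrals.
Context (d : measure_display) (T : measurableType d) (R : realType).
Variable P : probability T R.
Local Notation mu := (@lebesgue_measure R).
Variable G : R -> T -> R.
Hypotheses (mG : measurable_fun setT
    (fun z : T * measurableTypeR R => G z.2 z.1))
  (G0 : forall s w, 0 <= G s w).

Let f t (z : T * measurableTypeR R) : \bar R :=
  (G z.2 z.1 * (\1_(`[0, t]%classic : set R) z.2 : R))%:E.

Let f0 t z : (0 <= f t z)%E.
Proof. by rewrite lee_fin mulr_ge0. Qed.

Let mf t : measurable_fun setT (f t).
Proof.
apply/measurable_EFinP; apply: measurable_funM => //.
have m2 : measurable_fun setT (fun z : T * measurableTypeR R => (z.2 : R)).
  exact: (@measurable_snd _ _ T (measurableTypeR R)).
by apply: (measurableT_comp _ m2); exact: measurable_indic.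
Qed.

Let fE t w : (\int[mu]_(s in `[0%R, t]) (G s w)%:E = \int[mu]_s f t (w, s))%E.
Proof.
rewrite integral_mkcond; apply: eq_integral => s _.
by rewrite patchE /f/= indicE; case: ifPn => _; rewrite ?mulr1 ?mulr0.
Qed.

Lemma measurable_time_integral t :
  measurable_fun setT (fun w => \int[mu]_(s in `[0%R, t]) (G s w)%:E)%E.
Proof.
under eq_fun do rewrite fE.
exact: (@measurable_fun_fubini_tonelli_F _ _ T (measurableTypeR R) R mu (f t)).
Qed.

Lemma time_integral_tonelli t :
  (\int[P]_w \int[mu]_(s in `[0%R, t]) (G s w)%:E =
   \int[mu]_(s in `[0%R, t]) \int[P]_w (G s w)%:E)%E.
Proof.
under eq_integral do rewrite fE.
rewrite (@fubini_tonelli _ _ T (measurableTypeR R) R P mu (f t))//.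
rewrite [RHS]integral_mkcond; apply: eq_integral => s _.
rewrite patchE /f/= indicE; case: ifPn => _.
  by under eq_integral do rewrite mulr1.
by under eq_integral do rewrite mulr0; rewrite integral0.
Qed.

Lemma measurable_expectation_in_time :
  measurable_fun setT (fun s : measurableTypeR R => \int[P]_w (G s w)%:E)%E.
Proof.
have mG' : measurable_fun setT
    (fun z : T * measurableTypeR R => (G z.2 z.1)%:E) by exact/measurable_EFinP.
have G0' (z : T * measurableTypeR R) : (0 <= (G z.2 z.1)%:E)%E.
  by rewrite lee_fin.
exact: (@measurable_fun_fubini_tonelli_G _ _ _ _ _ P _ mG' G0').
Qed.

Lemma measurable_path w :
  measurable_fun setT (fun s : measurableTypeR R => G s w).
Proof. exact: (measurableT_comp mG (measurable_pair1 w)). Qed.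

End time_integrals.

(** * The exponential bound for the Ito integral *)

Section ito_exponential.
Context (d : measure_display) (T : measurableType d) (R : realType).
Variables (P : probability T R) (X0 : {RV P >-> R}) (W : R -> {RV P >-> R}).
Hypotheses (hW : is_wiener W) (hind : indep_of_process X0 W).
Local Notation F := (augmented_filtration X0 W).
Local Notation mu := (@lebesgue_measure R).

Lemma sp_coef_measurable (S : simple_process F) i :
  measurable_fun setT (sp_coef S i).
Proof.
have cF : sub_measurable (F (sp_time S i)) (sp_coef S i).
  exact: sp_coef_adapted.
exact: sub_augmented_filtration_measurable cF.
Qed.

Lemma measurable_sp_integral (S : simple_process F) t :
  measurable_fun setT (sp_integral W S t).
Proof.
apply: measurable_sum => i; apply: measurable_funM.
  exact: sp_coef_measurable.
exact: measurable_funB.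
Qed.

Lemma measurable_sp_qv (S : simple_process F) t :
  measurable_fun setT (sp_qv S t).
Proof.
apply: measurable_sum => i; apply: measurable_funM => //.
by apply: measurable_funX; exact: sp_coef_measurable.
Qed.

Lemma measurable_sp_value (S : simple_process F) :
  measurable_fun setT (fun z : T * measurableTypeR R => sp_value S z.2 z.1).
Proof.
apply: measurable_sum => i.
have m2 : measurable_fun setT (fun z : T * measurableTypeR R => (z.2 : R)).
  exact: (@measurable_snd _ _ T (measurableTypeR R)).
apply: measurable_funM.
  exact: measurableT_comp (sp_coef_measurable S i) measurable_fst.
by apply: (measurableT_comp _ m2); exact: measurable_indic.
Qed.

Variables (H : R -> T -> R) (t : R).
Hypotheses (t0 : 0 <= t) (mH : measurable_fun setT
    (fun z : T * measurableTypeR R => H (Num.max z.2 0) z.1))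
  (Hfin : forall w, (\int[mu]_(s in `[0%R, t]) (H s w ^+ 2)%:E < +oo)%E).

(* H is only controlled at non-negative times; Hx agrees with it on [0, t] and
   is jointly measurable on the whole line. *)
Let Hx s w := H (Num.max s 0) w.

Let HxE s w : s \in `[0, t]%classic -> H s w = Hx s w.
Proof. by rewrite inE/= in_itv/= /Hx => /andP[s0 _]; rewrite max_l. Qed.

Let mHx : measurable_fun setT (fun z : T * measurableTypeR R => Hx z.2 z.1).
Proof. exact: mH. Qed.

Let mHx2 : measurable_fun setT
  (fun z : T * measurableTypeR R => Hx z.2 z.1 ^+ 2).
Proof. exact: measurable_funX. Qed.

Let mdiff (S : simple_process F) : measurable_fun setT
  (fun z : T * measurableTypeR R => (sp_value S z.2 z.1 - Hx z.2 z.1) ^+ 2).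
Proof.
apply: measurable_funX; apply: measurable_funB => //.
exact: measurable_sp_value.
Qed.

Lemma measurable_sp_distance (S : simple_process F) : measurable_fun setT
  (fun w => \int[mu]_(s in `[0%R, t]) ((sp_value S s w - H s w) ^+ 2)%:E)%E.
Proof.
have := @measurable_time_integral _ T R
  (fun s w => (sp_value S s w - Hx s w) ^+ 2) (mdiff S)
  (fun s w => sqr_ge0 _) t.
apply: eq_measurable_fun => w _.
by apply: eq_integral => s st; rewrite -HxE.
Qed.

Let HHE w : (\int[mu]_(s in `[0%R, t]) (H s w ^+ 2)%:E =
  (\int[mu]_(s in `[0%R, t]) (H s w ^+ 2))%R%:E)%E.
Proof.
by rewrite /Rintegral fineK// ge0_fin_numE// integral_ge0// => s _; rewrite lee_fin sqr_ge0.
Qed.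

Lemma measurable_sqr_time_integral :
  measurable_fun setT (fun w => \int[mu]_(s in `[0, t]) (H s w ^+ 2)).
Proof.
apply/measurable_EFinP.
have := @measurable_time_integral _ T R (fun s w => Hx s w ^+ 2) mHx2
  (fun s w => sqr_ge0 _) t.
apply: eq_measurable_fun => w _ /=; rewrite -HHE.
by apply: eq_integral => s st; rewrite -HxE.
Qed.

(** Integrate S^2 <= 2 H^2 + 2 (S - H)^2 over [0, t]. *)
Lemma sp_qv_le (S : simple_process F) w :
  ((sp_qv S t w)%:E <=
   2%:E * (\int[mu]_(s in `[0, t]) (H s w ^+ 2))%R%:E +
   2%:E * \int[mu]_(s in `[0%R, t]) ((sp_value S s w - H s w) ^+ 2)%:E)%E.
Proof.
rewrite /sp_qv -(integral_sqr_step_sum (fun i => sp_coef S i w) (sp_time_nd S)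
  (sp_time_ge0 S) _ t0) -HHE.
rewrite [in X in (_ <= X + _)%E](eq_integral
  (fun s : measurableTypeR R => (Hx s w ^+ 2)%:E)); last first.
  by move=> s st; rewrite -HxE.
rewrite [in X in (_ <= _ + X)%E](eq_integral
  (fun s : measurableTypeR R => ((sp_value S s w - Hx s w) ^+ 2)%:E)); last first.
  by move=> s st; rewrite -HxE.
have m1 : measurable_fun `[0, t] (fun s : measurableTypeR R => (Hx s w ^+ 2)%:E).
  apply/measurable_EFinP; apply: measurable_funTS.
  exact: (measurable_path (G := fun s w => Hx s w ^+ 2) mHx2).
have m2 : measurable_fun `[0, t]
    (fun s : measurableTypeR R => ((sp_value S s w - Hx s w) ^+ 2)%:E).
  apply/measurable_EFinP; apply: measurable_funTS.
  exact: (measurable_path (G := fun s w => (sp_value S s w - Hx s w) ^+ 2) (mdiff S)).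
rewrite -!ge0_integralZl//; last 2 first.
- by move=> s _; rewrite lee_fin sqr_ge0.
- by move=> s _; rewrite lee_fin sqr_ge0.
rewrite -ge0_integralD//; last 4 first.
- by move=> s _; rewrite -EFinM lee_fin mulr_ge0// sqr_ge0.
- exact: measurable_funeM.
- by move=> s _; rewrite -EFinM lee_fin mulr_ge0// sqr_ge0.
- exact: measurable_funeM.
apply: ge0_le_integral => //.
- by move=> s _; rewrite lee_fin sqr_ge0.
- apply/measurable_EFinP; apply: measurable_funTS; apply: measurable_funX.
  exact: (measurable_path (G := fun s w => sp_value S s w) (measurable_sp_value S)).
- by apply: emeasurable_funD; exact: measurable_funeM.
- move=> s _; rewrite -!EFinM -EFinD lee_fin -/(sp_value S s w).
  by have := sqr_ge0 (sp_value S s w - 2 * Hx s w); nra.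
Qed.


(** The exponential moments of simple integrals pass to the Ito integral by
    Fatou's lemma. Bounding int Hn^2 by 2 int H^2 + 2 int (Hn - H)^2 avoids
    passing to the limit in int Hn^2; it turns l^2/2 into l^2, which is harmless
    since the bound is used for all l. *)
Lemma ito_exp_bound (M : R -> {RV P >-> R}) (l : R) :
  is_ito_integral F W H M ->
  (\int[P]_w (expR (l * M t w -
      l ^+ 2 * (\int[mu]_(s in `[0, t]) (H s w ^+ 2))%R))%:E <= 1)%E.
Proof.
case=> Hn /(_ t t0) [cvgD cvgM].
apply: (@exp_le1_in_probability _ _ _ P _ (fun n w =>
  l * sp_integral W (Hn n) t w - l ^+ 2 / 2 * sp_qv (Hn n) t w)).
- apply: measurable_funB; apply: measurable_funM => //.
  exact: measurable_sqr_time_integral.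
- move=> n; apply: measurable_funB; apply: measurable_funM => //.
    exact: measurable_sp_integral.
  exact: measurable_sp_qv.
- by move=> n; rewrite (simple_exp_moment hW hind).
move=> e e0.
(* Half of e is left for l (M t - Mn), and half for l^2 int (Hn - H)^2. *)
pose eps1 := e / 2 / (`|l| + 1); pose eps2 := e / 2 / (l ^+ 2 + 1).
have l1 : 0 < `|l| + 1 by rewrite ltr_wpDl.
have l2 : 0 < l ^+ 2 + 1 by rewrite ltr_wpDl// sqr_ge0.
have eps10 : 0 < eps1 by rewrite !divr_gt0.
have eps20 : 0 < eps2 by rewrite !divr_gt0.
pose B1 n := [set w | eps1 <= `|sp_integral W (Hn n) t w - M t w|].
pose D n w := (\int[mu]_(s in `[0%R, t]) ((sp_value (Hn n) s w - H s w) ^+ 2)%:E)%E.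
pose B2 n := [set w | (eps2%:E <= D n w)%E].
have mB1 n : measurable (B1 n).
  have -> : B1 n = setT `&`
      [set w | (eps1%:E <= (`|sp_integral W (Hn n) t w - M t w|)%:E)%E].
    by rewrite setTI; apply/seteqP; split=> w; rewrite /B1/= lee_fin.
  apply: measurable_lee => //; apply/measurable_EFinP/measurableT_comp => //.
  by apply: measurable_funB => //; exact: measurable_sp_integral.
have mB2 n : measurable (B2 n).
  rewrite /B2 -[X in measurable X]setTI; apply: measurable_lee => //.
  exact: measurable_sp_distance.
exists (fun n => B1 n `|` B2 n); split.
- by move=> n; exact: measurableU.
- apply: (@squeeze_cvge _ _ _ _ (cst 0%E) _ (fun n => P (B1 n) + P (B2 n))%E).
  + by near=> n; rewrite measure_ge0/= measureU2.
  + exact: cvg_cst.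
  + rewrite -[X in _ --> X]adde0; apply: cvgeD => //; first exact: cvgM.
    exact: cvgD.
move=> n w /not_orP[/negP]; rewrite /B1/= -ltNge => nB1 /negP.
rewrite /B2/= -ltNge => nB2.
have := sp_qv_le (Hn n) w; rewrite -/(D n w).
have Dfin : D n w \is a fin_num.
  rewrite ge0_fin_numE ?(lt_trans nB2) ?ltry//.
  by apply: integral_ge0 => s _; rewrite lee_fin sqr_ge0.
move: nB2; rewrite -(fineK Dfin) lte_fin -!EFinM -EFinD lee_fin.
set h := Rintegral _ _ _; set q := sp_qv _ _ _; set Di := fine _.
set m := sp_integral _ _ _ _ in nB1 *; set M' := M t w in nB1 *.
move=> De q_le.
have lM : l * (M' - m) <= e / 2.
  apply: (le_trans (ler_norm _)); rewrite normrM distrC.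
  rewrite (_ : e / 2 = (`|l| + 1) * eps1); last first.
    by rewrite /eps1; field; rewrite gt_eqF.
  by apply: ler_pM => //; [rewrite lerDl|exact: ltW].
have lD : l ^+ 2 * Di <= e / 2.
  rewrite (_ : e / 2 = (l ^+ 2 + 1) * eps2); last first.
    by rewrite /eps2; field; rewrite gt_eqF.
  apply: (@le_trans _ _ (l ^+ 2 * eps2)).
    by rewrite ler_wpM2l ?sqr_ge0// ltW.
  by rewrite ler_wpM2r ?lerDl// ltW.
have lq : l ^+ 2 / 2 * q <= l ^+ 2 * h + l ^+ 2 * Di.
  have : l ^+ 2 / 2 * q <= l ^+ 2 / 2 * (2 * h + 2 * Di).
    by rewrite ler_wpM2l// divr_ge0// sqr_ge0.
  by rewrite (_ : l ^+ 2 / 2 * (2 * h + 2 * Di) = l ^+ 2 * h + l ^+ 2 * Di)//; field.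
lra.
Unshelve. all: by end_near. Qed.

End ito_exponential.

(** * The mean of the CIR process *)

Section ae_integrals.
Context (d : measure_display) (T : measurableType d) (R : realType).
Variable P : {measure set T -> \bar R}.
Implicit Types f g : T -> R.

Lemma ae_integrable_le f g : measurable_fun setT f ->
  {ae P, forall w, `|f w| <= g w} -> P.-integrable setT (EFin \o g) ->
  P.-integrable setT (EFin \o f).
Proof.
move=> mf fg ig; apply/integrableP; split; first exact/measurable_EFinP.
have /integrableP[_] := integrable_abse ig.
have mg := integrable_measurable ig.
apply: le_lt_trans; under [leRHS]eq_integral do rewrite /= normr_id.
apply: ae_ge0_le_integral => //.
- by apply/measurable_EFinP; exact: measurableT_comp.
- by apply/measurable_EFinP; exact: measurableT_comp.
- apply: filterS fg => w fg _; rewrite lee_fin; exact: le_trans (ler_norm _).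
Qed.

Lemma ae_eq_Rintegral f g : measurable_fun setT f -> measurable_fun setT g ->
  {ae P, forall w, f w = g w} -> \int[P]_w f w = \int[P]_w g w.
Proof.
move=> mf mg fg; congr fine; apply: ae_eq_integral => //.
- exact/measurable_EFinP.
- exact/measurable_EFinP.
- by apply: filterS fg => w -> _.
Qed.

End ae_integrals.

Section cir_mean.
Context (d : measure_display) (T : measurableType d) (R : realType).
Variables (P : probability T R) (alpha mu sigma : R)
  (W : R -> {RV P >-> R}) (X0 : {RV P >-> R}) (X : R -> {RV P >-> R}).
Hypotheses (alpha0 : 0 < alpha) (sigma0 : 0 < sigma)
  (hW : is_wiener W) (X0int : P.-integrable setT (EFin \o X0))
  (hind : indep_of_process X0 W)
  (hX : is_cir_solution alpha mu sigma W X0 X).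
Local Notation leb := (@lebesgue_measure R).

(* The time integral of X enters through H^2, which is non-negative at every
   outcome, and equals X at the outcomes whose path is non-negative. *)
Let H s w := Num.sqrt (X s w).
Let I t w := \int[leb]_(s in `[0, t]) (H s w ^+ 2).

Let cX w : {within `[0, +oo[, continuous (fun s => X s w)}.
Proof. by case: hX. Qed.

Let mH : measurable_fun setT
  (fun z : T * measurableTypeR R => H (Num.max z.2 0) z.1).
Proof.
apply: measurable_fun_sqrt.
exact: (@measurable_continuous_process _ T R X).
Qed.

Let cH2 w : {within `[0, +oo[, continuous (fun s => H s w ^+ 2)}.
Proof.
have -> : (fun s => H s w ^+ 2) =
    (fun x : R => Num.sqrt x ^+ 2) \o (fun s => X s w) by [].
apply: within_continuous_comp; last exact: cX.
move=> x _; apply: (@continuous_comp _ _ _ (@Num.sqrt R) (fun y => y ^+ 2)).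
  exact: sqrt_continuous.
exact: exprn_continuous.
Qed.

Let sub_itv (t : R) : `[0, t] `<=` `[0, +oo[%classic.
Proof. by move=> s; rewrite /= !in_itv/= andbT => /andP[]. Qed.

Let iH2 t w : leb.-integrable `[0, t] (EFin \o (fun s => H s w ^+ 2)).
Proof.
have := continuous_subspaceW (sub_itv (t := t)) (@cH2 w).
by apply: continuous_compact_integrable; exact: segment_compact.
Qed.

Let iX t w : leb.-integrable `[0, t] (EFin \o (fun s => X s w)).
Proof.
have := continuous_subspaceW (sub_itv (t := t)) (@cX w).
by apply: continuous_compact_integrable; exact: segment_compact.
Qed.

Let Hfin t w : (\int[leb]_(s in `[0%R, t]) (H s w ^+ 2)%:E < +oo)%E.
Proof. exact: integrable_lty (iH2 t w). Qed.

Let mI t : measurable_fun setT (I t).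
Proof. exact: measurable_sqr_time_integral mH (Hfin t). Qed.

Let I_ge0 t w : 0 <= I t w.
Proof. by apply: Rintegral_ge0 => s _; exact: sqr_ge0. Qed.

Let cst_integral t (c : R) : 0 <= t -> \int[leb]_(s in `[0, t]) c = c * t.
Proof.
move=> t0; rewrite Rintegral_cst//= lebesgue_measure_itv/= lte_fin.
case: ltP => [_|t0'] /=; first by rewrite oppr0 addr0.
by rewrite (@le_anti _ _ t 0) ?mulr0// t0 t0'.
Qed.

Let icst t (c : R) : leb.-integrable `[0, t] (EFin \o (fun=> c)).
Proof.
have : {within `[0, t], continuous (fun _ : R => c)}.
  by apply: continuous_subspaceT => x; exact: cvg_cst.
by apply: continuous_compact_integrable; exact: segment_compact.
Qed.

(** All that is retained of the stochastic differential equation: the exponential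
    bounds of the Ito integral and the equation at time t. *)
Lemma cir_integral_equation t : 0 <= t -> exists M : {RV P >-> R},
  (forall l, (\int[P]_w (expR (l * M w - l ^+ 2 * I t w))%:E <= 1)%E) /\
  {ae P, forall w, 0 <= X t w /\
     X t w = X0 w + alpha * mu * t - alpha * I t w + sigma * M w}.
Proof.
move=> t0; case: hX => _ _ Xge0 [M itoM XE]; exists (M t); split.
  by move=> l; apply: (ito_exp_bound hW hind t0 mH (Hfin t)).
apply: filterS2 Xge0 (XE t t0) => w Xw E; split; first exact: Xw.
rewrite E; congr (_ + _); rewrite -addrA; congr (_ + _).
have iB : leb.-integrable `[0, t] (EFin \o (fun s => mu - X s w)).
  by apply: eq_integrable (integrableB _ (icst t mu) (@iX t w)).
rewrite RintegralZl// RintegralB//.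
rewrite cst_integral// mulrBr mulrA; congr (_ - _ * _).
apply: eq_Rintegral => s; rewrite inE/= in_itv/= => /andP[s0 _].
by rewrite /H sqr_sqrtr// Xw.
Qed.

(** Expressing M through the equation, the exponent l M - l^2 I contains I t with
    coefficient l (alpha / sigma - l), which is positive for
    l = alpha / (2 sigma). As Y <= exp Y, the exponential bound then controls
    both X t and I t. *)
Lemma cir_integrable t : 0 <= t ->
  P.-integrable setT (EFin \o X t) /\ P.-integrable setT (EFin \o I t).
Proof.
move=> t0; have [M [expM XE]] := cir_integral_equation t0.
pose Y w := alpha / (2 * sigma) * M w - (alpha / (2 * sigma)) ^+ 2 * I t w.
(* k normalizes to 1 the coefficient of X t in k * Y. *)
pose k := 2 * sigma ^+ 2 / alpha.
have k0 : 0 <= k by rewrite divr_ge0 ?ltW// mulr_gt0// exprn_gt0.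
have mY : measurable_fun setT Y by apply: measurable_funB; exact: measurable_funM.
have iexpY : P.-integrable setT (EFin \o (fun w => expR (Y w))).
  apply: ge0_integrable_lty; first exact: measurableT_comp.
    by move=> w; exact: expR_ge0.
  by apply: le_lt_trans (expM (alpha / (2 * sigma))) _; rewrite ltry.
have i1 : P.-integrable setT (EFin \o (fun w => k * expR (Y w))).
  by apply: eq_integrable (integrableZl measurableT k iexpY).
have i2 : P.-integrable setT (EFin \o (fun w => `|X0 w|)).
  exact: integrable_norm X0int.
have i3 : P.-integrable setT (EFin \o (fun=> alpha * `|mu| * t)).
  exact: finite_measure_integrable_cst.
have i23 : P.-integrable setT (EFin \o (fun w => `|X0 w| + alpha * `|mu| * t)).
  by apply: eq_integrable (integrableD measurableT i2 i3).
have ig : P.-integrable setT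
    (EFin \o (fun w => `|X0 w| + alpha * `|mu| * t + k * expR (Y w))).
  by apply: eq_integrable (integrableD measurableT i23 i1).
have bound : {ae P, forall w, X t w + alpha / 2 * I t w <=
    `|X0 w| + alpha * `|mu| * t + k * expR (Y w)}.
  apply: filterS XE => w [_ E].
  have -> : X t w + alpha / 2 * I t w = X0 w + alpha * mu * t + k * Y w.
    rewrite E /k /Y; field.
    by rewrite !gt_eqF.
  apply: lerD; first apply: lerD; first exact: ler_norm.
    by rewrite ler_wpM2r// ler_wpM2l ?ler_norm// ltW.
  by rewrite ler_wpM2l// (le_trans _ (expR_ge1Dx _))// lerDr.
have half0 : 0 <= alpha / 2 by rewrite divr_ge0// ltW.
split.
  apply: (ae_integrable_le _ _ ig) => //.
  apply: filterS2 XE bound => w [Xw _]; apply: le_trans.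
  by rewrite ger0_norm// lerDl mulr_ge0.
have iI : P.-integrable setT (EFin \o (fun w => alpha / 2 * I t w)).
  apply: (ae_integrable_le _ _ ig); first exact: measurable_funM.
  apply: filterS2 XE bound => w [Xw _]; apply: le_trans.
  rewrite ger0_norm; last by rewrite mulr_ge0.
  by rewrite -[X in X <= _]add0r lerD2r.
have := integrableZl measurableT (alpha / 2)^-1 iI.
apply: eq_integrable => // w _ /=.
by rewrite -EFinM mulKf// mulf_neq0 ?invr_neq0// gt_eqF.
Qed.

Local Notation m t := (\int[P]_w X t w).

(** X t and I t being integrable, so is M, and its exponential bounds force its
    mean to be zero. *)
Lemma cir_mean_time_integral t : 0 <= t ->
  m t = \int[P]_w X0 w + alpha * mu * t - alpha * \int[P]_w I t w.
Proof.
move=> t0; have [iXt iI] := cir_integrable t0.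
have [M [expM XE]] := cir_integral_equation t0.
have iaI : P.-integrable setT (EFin \o (fun w => alpha * I t w)).
  by apply: eq_integrable (integrableZl measurableT alpha iI).
have ic : P.-integrable setT (EFin \o (fun=> alpha * mu * t)).
  exact: finite_measure_integrable_cst.
have i0c : P.-integrable setT (EFin \o (fun w => X0 w + alpha * mu * t)).
  by apply: eq_integrable (integrableD measurableT X0int ic).
have i0cI : P.-integrable setT
    (EFin \o (fun w => X0 w + alpha * mu * t - alpha * I t w)).
  by apply: eq_integrable (integrableB measurableT i0c iaI).
have idiff : P.-integrable setT
    (EFin \o (fun w => X t w - (X0 w + alpha * mu * t - alpha * I t w))).
  by apply: eq_integrable (integrableB measurableT iXt i0cI).
have isM : P.-integrable setT (EFin \o (fun w => sigma * M w)).
  apply: (@ae_integrable_le _ _ _ P _ (fun w =>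
    `|X t w - (X0 w + alpha * mu * t - alpha * I t w)|)).
  - exact: measurable_funM.
  - by apply: filterS XE => w [_ ->]; rewrite [X in `|X - _|]addrC addrK.
  - exact: integrable_norm idiff.
have iM : P.-integrable setT (EFin \o M).
  have := integrableZl measurableT sigma^-1 isM.
  by apply: eq_integrable => // w _ /=; rewrite -EFinM mulKf// gt_eqF.
have EM := exp_supermartingale_mean0 iM iI expM.
rewrite (@ae_eq_Rintegral _ _ _ P _
  (fun w => X0 w + alpha * mu * t - alpha * I t w + sigma * M w)) //.
- rewrite RintegralD// RintegralB// RintegralD// Rintegral_prob_cst.
  by rewrite !RintegralZl// EM mulr0 addr0.
- apply: measurable_funD; last exact: measurable_funM.
  by apply: measurable_funB; [exact: measurable_funD|exact: measurable_funM].
- by apply: filterS XE => w [].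
Qed.

Lemma cir_mean_ge0 t : 0 <= t -> 0 <= m t.
Proof.
move=> t0; rewrite (@ae_eq_Rintegral _ _ _ P _ (fun w => `|X t w|))//.
- exact: Rintegral_ge0.
- exact: measurableT_comp.
have [M [_ XE]] := cir_integral_equation t0.
by apply: filterS XE => w [Xw _]; rewrite ger0_norm.
Qed.

Let mean_sqr s : 0 <= s -> (\int[P]_w (H s w ^+ 2)%:E)%E = (m s)%:E.
Proof.
move=> s0; have [iXs _] := cir_integrable s0.
rewrite fineK; last exact: integrable_fin_num iXs.
have [M [_ XE]] := cir_integral_equation s0.
apply: ae_eq_integral => //.
- by apply/measurable_EFinP; apply: measurable_funX; exact: measurable_fun_sqrt.
- exact/measurable_EFinP.
- by apply: filterS XE => w [Xw _] _; rewrite /H sqr_sqrtr.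
Qed.

(** Tonelli's theorem exchanges expectation and time integral. *)
Lemma cir_mean_equation t : 0 <= t ->
  leb.-integrable `[0, t] (EFin \o (fun s => m s)) /\
  m t = \int[P]_w X0 w + alpha * mu * t - alpha * \int[leb]_(s in `[0, t]) m s.
Proof.
move=> t0.
have mH2 : measurable_fun setT
    (fun z : T * measurableTypeR R => H (Num.max z.2 0) z.1 ^+ 2).
  exact: measurable_funX.
have G0 s w : 0 <= H (Num.max s 0) w ^+ 2 by exact: sqr_ge0.
have maxE s : s \in `[0, t]%classic -> Num.max s 0 = s.
  by rewrite inE/= in_itv/= => /andP[s0 _]; rewrite max_l.
have mm : measurable_fun `[0, t] (fun s : measurableTypeR R => (m s)%:E).
  have := @measurable_expectation_in_time _ T R P
    (fun s w => H (Num.max s 0) w ^+ 2) mH2 G0.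
  move=> /(measurable_funTS (D := `[0, t]%classic)).
  apply: eq_measurable_fun => s st; rewrite maxE// mean_sqr//.
  by move: st; rewrite inE/= in_itv/= => /andP[].
have E : (\int[P]_w (I t w)%:E = \int[leb]_(s in `[0%R, t]) (m s)%:E)%E.
  rewrite (eq_integral (fun w =>
    \int[leb]_(s in `[0%R, t]) (H (Num.max s 0) w ^+ 2)%:E)%E); last first.
    move=> w _; rewrite /I /Rintegral fineK; last exact: integrable_fin_num (@iH2 t w).
    by apply: eq_integral => s st; rewrite maxE.
  rewrite (@time_integral_tonelli _ T R P (fun s w => H (Num.max s 0) w ^+ 2))//.
  apply: eq_integral => s st; rewrite maxE// mean_sqr//.
  by move: st; rewrite inE/= in_itv/= => /andP[].
have [_ iI] := cir_integrable t0.
split; last by rewrite cir_mean_time_integral// /Rintegral E.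
apply/integrableP; split=> //.
rewrite (eq_integral (fun s : measurableTypeR R => (m s)%:E)); last first.
  move=> s; rewrite inE/= in_itv/= => /andP[s0 _].
  by rewrite ger0_norm// cir_mean_ge0.
rewrite -E; exact: integrable_lty iI.
Qed.

End cir_mean.

(** * The linear equation of the mean *)

Section mean_reversion.
Context (R : realType).
Local Notation leb := (@lebesgue_measure R).
Variables (m : R -> R) (c alpha mu : R).
Hypotheses (alpha0 : 0 < alpha) (mE : forall t, 0 <= t ->
  leb.-integrable `[0, t] (EFin \o m) /\
  m t = c + alpha * mu * t - alpha * \int[leb]_(s in `[0, t]) m s).

(* Integrability makes A continuous, the equation then makes m continuous, and so
   A is differentiable with derivative m at positive times. *)
Let A t := \int[leb]_(s in `[0, t]) m s.

Let A_continuous (x : R) : 0 < x -> {for x, continuous A}.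
Proof.
move=> x0; have x1 : 0 < x + 1 by rewrite addr_gt0.
have [im _] := mE (ltW x1).
have cA : {within `[0, x + 1], continuous A}.
  exact: parameterized_integral_continuous (ltW x1) im.
apply: (within_continuous_continuous x1 cA).
by rewrite in_itv/= x0 ltrDl ltr01.
Qed.

Let m_continuous (x : R) : 0 < x -> {for x, continuous m}.
Proof.
move=> x0; have mx := (mE (ltW x0)).2; rewrite -/(A x) in mx.
have cg : (fun t => c + alpha * mu * t - alpha * A t) @ x -->
    c + alpha * mu * x - alpha * A x.
  apply: cvgB.
    apply: cvgD; first exact: cvg_cst.
    by apply: cvgM; [exact: cvg_cst|exact: cvg_id].
  by apply: cvgM; [exact: cvg_cst|exact: A_continuous].
rewrite -mx in cg; apply: cvg_trans cg; apply: near_eq_cvg; near=> t.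
rewrite (mE _).2//; apply: ltW; near: t; exact: lt_nbhsr.
Unshelve. all: by end_near. Qed.

Let A_derive (x : R) : 0 < x -> is_derive x 1 A (m x).
Proof.
move=> x0; have x1 : x < x + 1 by rewrite ltrDl.
have [im _] := mE (ltW (lt_trans x0 x1)).
have [dA dAE] := continuous_FTC1_closed x1 im x0 (m_continuous x0).
by rewrite -dAE derive1E; exact: DeriveDef.
Qed.

Let v t := expR (alpha * t) * (c + alpha * mu * t - alpha * A t - mu).

Let v_derive (x : R) : 0 < x -> is_derive x 1 v 0.
Proof.
move=> x0; have dA := A_derive x0.
have mx := (mE (ltW x0)).2; rewrite -/(A x) in mx.
apply: is_derive_eq.
by rewrite mx /GRing.scale/=; ring.
Qed.

Let v_constant t : 1 <= t -> v t = v 1.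
Proof.
move=> t1.
have v_der (x : R) : x \in `]1, t[ -> is_derive x 1 v ((fun=> 0) x).
  rewrite in_itv/= => /andP[x1 _]; apply: v_derive.
  exact: lt_trans x1.
have cv : {within `[1, t], continuous v}.
  apply: derivable_within_continuous => x; rewrite in_itv/= => /andP[x1 _].
  by case: (v_derive (lt_le_trans ltr01 x1)).
have [y _] := MVT_segment t1 v_der cv.
by rewrite mul0r => /subr0_eq.
Qed.

(** The integrating factor exp(alpha t) makes v = exp(alpha t) (m t - mu) constant
    on positive times, so m t - mu decays like exp(- alpha t). *)
Lemma mean_reversion_cvg : m t @[t --> +oo] --> mu.
Proof.
have lim : mu + v 1 * expR (- (alpha * t)) @[t --> +oo] --> mu.
  rewrite -[X in _ --> X]addr0 -(mulr0 (v 1)).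
  apply: cvgD; first exact: cvg_cst.
  apply: cvgM; first exact: cvg_cst.
  apply: (cvg_comp (fun t => alpha * t) (fun x => expR (- x)) _ (@cvgr_expR R)).
  by apply: gt0_cvgMry => //; exact: cvg_id.
apply: cvg_trans lim; apply: near_eq_cvg; near=> t.
have t1 : 1 <= t by near: t; exact: nbhs_pinfty_ge.
have t0 : 0 <= t := le_trans ler01 t1.
rewrite -(v_constant t1) /v (mE t0).2 -/(A t) mulrAC -expRD subrr expR0 mul1r.
by rewrite addrC subrK.
Unshelve. all: by end_near. Qed.

End mean_reversion.

Unset Implicit Arguments.
Set Strict Implicit.

Theorem theorem4p1 (d : measure_display) (T : measurableType d) (R : realType)
    (P : probability T R) (alpha mu sigma theta Delta : R)
    (W : R -> {RV P >-> R}) (X0 : {RV P >-> R})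
    (halpha : 0 < alpha) (hmu : 0 < mu) (hsigma : 0 < sigma)
    (hfeller : 0 <= 4 * alpha * mu - sigma ^+ 2)
    (htheta : 1 <= theta) (hDelta : 0 < Delta)
    (hW : is_wiener W)
    (hX0 : {ae P, forall w, 0 <= X0 w})
    (hX0int : P.-integrable setT (EFin \o X0))
    (hindep : indep_of_process X0 W) :
  'E_P[theta_milstein alpha mu sigma theta Delta W X0 n]%E
    @[n --> \oo] --> mu%:E
  /\ (forall X : R -> {RV P >-> R},
        is_cir_solution alpha mu sigma W X0 X ->
        'E_P[X t]%E @[t --> +oo] --> mu%:E).
Proof.
split; first exact: theta_milstein_mean_cvg.
move=> X hX.
have mE t (t0 : 0 <= t) :=
  cir_mean_equation halpha hsigma hW hX0int hindep hX t0.
rewrite (_ : (fun t => 'E_P[X t]%E) = (fun t => \int[P]_w (X t w)%:E)%E);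
  last by apply/funext => t; rewrite unlock.
apply: cvg_EFin; last exact: mean_reversion_cvg halpha mE.
near=> t; apply: integrable_fin_num => //.
have t0 : 0 <= t by near: t; exact: nbhs_pinfty_ge.
by have [] := cir_integrable halpha hsigma hW hX0int hindep hX t0.
Unshelve. all: by end_near. Qed.
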